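(* Let $p$ be a prime and let $(t_n)_{n\ge1}$ be a sequence of positive integers with $t_n\le n$ for each $n$ and $\lim_{n\to\infty}(t_n-\log_p n)=\infty$. Then for each $n$ there exist subsets $\sigma_{n,1},\ldots,\sigma_{n,n}\subseteq[n]$ with $1\le|\sigma_{n,i}|\le t_n$ for all $i$ and $\bigcup_{i=1}^n\sigma_{n,i}=[n]$ such that, if $X_n$ is a Haar-random $n\times n$ matrix over $\mathbb{Z}_p$ supported on $\Sigma_n=(\sigma_{n,1},\ldots,\sigma_{n,n})$, then $$\lim_{n\to\infty}\mathbb{E}\big(\#\mathrm{Sur}(\mathrm{cok}(X_n),\mathbb{Z}/p\mathbb{Z})\big)=1.$$
   Context: $[n]=\{1,\ldots,n\}$. A random matrix $X_n\in \mathrm{M}_n(\mathbb{Z}_p)$ is a Haar-random matrix supported on $\Sigma_n=(\sigma_{n,1},\ldots,\sigma_{n,n})$ if $(X_n)_{i,j}=0$ whenever $i\notin\sigma_{n,j}$, and the entries $(X_n)_{i,j}$ with $i\in\sigma_{n,j}$ are independent and Haar-distributed on $\mathbb{Z}_p$. $\mathrm{Sur}(A,B)$ denotes the set of surjective group homomorphisms $A\to B$. *)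

(* Defs.v *)
From HB Require Import structures.
From mathcomp Require Import all_boot all_order all_algebra.
From mathcomp Require Import all_classical all_reals all_analysis.

Set Implicit Arguments.
Unset Strict Implicit.
Unset Printing Implicit Defensive.
Import Order.TTheory GRing.Theory Num.Theory.
Import numFieldNormedType.Exports.
Local Open Scope classical_set_scope.
Local Open Scope ring_scope.

(* The ring of p-adic integers, as the inverse limit of the rings Z/p^(k+1).
   Component [k] is the residue modulo p^(k+1): starting at exponent 1 avoids
   'Z_(p ^ 0), which MathComp interprets as Z/2.  Only the case of a prime p is
   meaningful; for p < 2 every 'Z_(p ^ k.+1) is Z/2, so the construction still
   yields some ring and the instances below need no hypothesis on p. *)
Record padic (p : nat) := Padic {
  padic_res :> forall k, 'Z_(p ^ k.+1) ;
  padic_compat : forall k, ((padic_res k.+1 : nat)%:R : 'Z_(p ^ k.+1))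
                           = padic_res k }.

Section PadicRing.
Variable p : nat.
Implicit Types x y z : padic p.

HB.instance Definition _ := gen_eqMixin (padic p).
HB.instance Definition _ := gen_choiceMixin (padic p).

Lemma padicP x y : (forall k, x k = y k) -> x = y.
Proof.
case: x y => [x xP] [y yP] /= exy.
have {}exy : x = y by apply: functional_extensionality_dep.
by subst y; congr Padic; apply: Prop_irrelevance.
Qed.

Lemma padic_modulus_dvd k :
  ((Zp_trunc (p ^ k.+1)).+2 %| (Zp_trunc (p ^ k.+2)).+2)%N.
Proof.
have [p1|p1] := leqP p 1.
  by case: p p1 => [|[|//]] _; rewrite ?exp0n ?exp1n.
have gt1 j : (1 < p ^ j.+1)%N by rewrite -(exp1n j.+1) ltn_exp2r.
by rewrite !Zp_cast //; apply: dvdn_exp2l.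
Qed.

Lemma Zp_nat_mod a (m n : nat) : (m = n %[mod a.+2])%N ->
  m%:R = n%:R :> 'I_a.+2.
Proof. by move=> mn; rewrite !Zp_nat; apply: val_inj. Qed.

Lemma padic_redD k (u v : 'Z_(p ^ k.+2)) :
  ((u + v)%R : nat)%:R =
  (u : nat)%:R + (v : nat)%:R :> 'Z_(p ^ k.+1).
Proof.
by rewrite -natrD; apply: Zp_nat_mod; rewrite /= modn_dvdm // padic_modulus_dvd.
Qed.

Lemma padic_redM k (u v : 'Z_(p ^ k.+2)) :
  ((u * v)%R : nat)%:R =
  (u : nat)%:R * (v : nat)%:R :> 'Z_(p ^ k.+1).
Proof.
by rewrite -natrM; apply: Zp_nat_mod; rewrite /= modn_dvdm // padic_modulus_dvd.
Qed.

Fact padic_add_compat x y k :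
  ((x k.+1 + y k.+1)%R : nat)%:R = x k + y k.
Proof. by rewrite padic_redD !padic_compat. Qed.

Fact padic_mul_compat x y k :
  ((x k.+1 * y k.+1)%R : nat)%:R = x k * y k.
Proof. by rewrite padic_redM !padic_compat. Qed.

Fact padic_opp_compat x k :
  ((- x k.+1)%R : nat)%:R = - x k.
Proof.
by apply/eqP; rewrite -addr_eq0 -(padic_compat x k) -padic_redD addNr.
Qed.

Fact padic_zero_compat k :
  ((0%R : 'Z_(p ^ k.+2)) : nat)%:R = 0 :> 'Z_(p ^ k.+1).
Proof. by []. Qed.

Fact padic_one_compat k :
  ((1%R : 'Z_(p ^ k.+2)) : nat)%:R = 1 :> 'Z_(p ^ k.+1).
Proof. by []. Qed.

Definition padic_zero := @Padic p (fun=> 0) padic_zero_compat.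
Definition padic_one := @Padic p (fun=> 1) padic_one_compat.
Definition padic_opp x := @Padic p (fun k => - x k) (padic_opp_compat x).
Definition padic_add x y :=
  @Padic p (fun k => x k + y k) (padic_add_compat x y).
Definition padic_mul x y :=
  @Padic p (fun k => x k * y k) (padic_mul_compat x y).

Fact padic_addA : associative padic_add.
Proof. by move=> x y z; apply: padicP => k /=; rewrite addrA. Qed.
Fact padic_addC : commutative padic_add.
Proof. by move=> x y; apply: padicP => k /=; rewrite addrC. Qed.
Fact padic_add0 : left_id padic_zero padic_add.
Proof. by move=> x; apply: padicP => k /=; rewrite add0r. Qed.
Fact padic_addN : left_inverse padic_zero padic_opp padic_add.
Proof. by move=> x; apply: padicP => k /=; rewrite addNr. Qed.
Fact padic_mulA : associative padic_mul.
Proof. by move=> x y z; apply: padicP => k /=; rewrite mulrA. Qed.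
Fact padic_mulC : commutative padic_mul.
Proof. by move=> x y; apply: padicP => k /=; rewrite mulrC. Qed.
Fact padic_mul1 : left_id padic_one padic_mul.
Proof. by move=> x; apply: padicP => k /=; rewrite mul1r. Qed.
Fact padic_mulDl : left_distributive padic_mul padic_add.
Proof. by move=> x y z; apply: padicP => k /=; rewrite mulrDl. Qed.
Fact padic_one_neq0 : padic_one != padic_zero.
Proof.
apply/eqP => /(congr1 (fun x : padic p => x 0%N)) /= /eqP.
by rewrite oner_eq0.
Qed.

HB.instance Definition _ := GRing.isZmodule.Build (padic p)
  padic_addA padic_addC padic_add0 padic_addN.
HB.instance Definition _ := GRing.Zmodule_isComNzRing.Build (padic p)
  padic_mulA padic_mulC padic_mul1 padic_mulDl padic_one_neq0.
HB.instance Definition _ := isPointed.Build (padic p) 0.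

End PadicRing.

Section PadicBorel.
Variable p : nat.

(* The p-adic topology: the balls x + p^(k+1) Z_p form a basis of
   neighbourhoods of x. *)
Definition padic_open : set (set (padic p)) :=
  [set U | forall x : padic p, U x ->
    exists k, forall y : padic p, y k = x k -> U y].

Fact padic_openT : padic_open setT.
Proof. by move=> x _; exists 0%N. Qed.

Lemma padic_res_le (x y : padic p) k l :
  (k <= l)%N -> y l = x l -> y k = x k.
Proof.
move=> /subnK <-; elim: (l - k)%N => [//|j IH] /= e; apply: IH.
by rewrite -(padic_compat x) -(padic_compat y) -[(j + k).+1]addSn e.
Qed.

Fact padic_openI : setI_closed padic_open.
Proof.
move=> U V oU oV x [/oU[k Uk] /oV[l Vl]]; exists (maxn k l) => y yx; split.
  by apply/Uk/(padic_res_le _ yx)/leq_maxl.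
by apply/Vl/(padic_res_le _ yx)/leq_maxr.
Qed.

Fact padic_open_bigU (I : Type) (f : I -> set (padic p)) :
  (forall i, padic_open (f i)) -> padic_open (\bigcup_i f i).
Proof.
by move=> of_ x [i _ /of_[k fk]]; exists k => y /fk fy; exists i.
Qed.

HB.instance Definition _ := isOpenTopological.Build (padic p)
  padic_openT padic_openI padic_open_bigU.

Lemma padic_openE : @open (padic p) = padic_open.
Proof. by []. Qed.

Definition padic_display := sigma_display (@open (padic p)).

HB.instance Definition _ := @isMeasurable.Build padic_display (padic p)
  <<s @open (padic p) >> (@sigma_algebra0 _ setT _) (@sigma_algebraC _ _)
  (@sigma_algebra_bigcup _ setT _).

End PadicBorel.

(* A probability measure on Z_p is the (normalised) Haar measure when it is
   translation invariant. *)
Definition is_haar (R : realType) (p : nat)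
    (mu : set (padic p) -> \bar R) : Prop :=
  mu setT = 1%E /\
  forall (a : padic p) (A : set (padic p)), measurable A ->
    mu [set a + x | x in A] = mu A.

Definition mutually_independent (R : realType) (d d' : measure_display)
    (T : measurableType d) (E : measurableType d') (P : probability T R)
    (I : finType) (D : {set I}) (X : I -> T -> E) : Prop :=
  forall (J : {set I}) (A : I -> set E), J \subset D ->
    (forall i, i \in J -> measurable (A i)) ->
    P (\bigcap_(i in [set` J]) (X i @^-1` A i)) =
    (\prod_(i in J) P (X i @^-1` A i))%E.

(* [sigma j] is the set of rows in which column [j] may be nonzero. *)
Definition haar_random_supported (R : realType) (p n : nat)
    (d : measure_display) (T : measurableType d) (P : probability T R)
    (sigma : 'I_n -> {set 'I_n}) (X : T -> 'M[padic p]_n) : Prop :=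
  [/\ forall i j, measurable_fun setT (fun w => X w i j),
      forall w i j, i \notin sigma j -> X w i j = 0,
      forall i j, i \in sigma j ->
        is_haar (pushforward P (fun w => X w i j)) &
      mutually_independent P [set ij : 'I_n * 'I_n | ij.1 \in sigma ij.2]%SET
        (fun ij w => X w ij.1 ij.2)].

Section Cokernel.
Variables (p n : nat) (M : 'M[padic p]_n).

Definition col_image : {pred 'cV[padic p]_n} :=
  fun v => `[< exists w : 'cV[padic p]_n, v = M *m w >].

Fact col_image_zmod_closed : zmod_closed col_image.
Proof.
split; first by apply/asboolP; exists 0; rewrite mulmx0.
move=> u v /asboolP[u' ->] /asboolP[v' ->]; apply/asboolP.
by exists (u' - v'); rewrite mulmxBr.
Qed.

HB.instance Definition _ := GRing.isZmodClosed.Build _ col_image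
  col_image_zmod_closed.

(* cok(M) = Z_p^n / M Z_p^n *)
Definition cok : zmodType := Quotient.quot col_image.

End Cokernel.

Definition Sur (A B : zmodType) : set (A -> B) :=
  [set f | {morph f : x y / x + y} /\ set_surj setT setT f].
Arguments Sur : clear implicits.

(* Main.v *)
(* A surjection cok(X) -> Z/p is a nonzero row vector phi over Z/p with
   phi X = 0 mod p, and column j of X is killed by phi with probability 1 or 1/p
   according to whether sigma_j misses the support S of phi.  So the expectation
   is the sum over nonempty S of (p-1)^|S| p^-h(S), with h(S) the number of
   sigma_j meeting S.  Expanding p^(n-h(S)) as the sum of (p-1)^|J| over the sets
   J of columns missing S, this is 1 - p^-n plus an excess
     p^-n sum_(S, J nonempty, J missing S) (p-1)^(|S|+|J|).

   Take sigma_j = {f_1(j), ..., f_t(j)} for permutations f_k; the row and column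
   degrees are then both about t and the sigma_j cover [n].  When the f_k are
   independent and uniform, J misses S with probability r^t, where r is at most
   (1-|J|/n)^|S| and (1-|S|/n)^|J|, so some choice of the f_k has excess at most
   the average.  By symmetry assume |S| <= |J|.  The sum over J is a moment of a
   binomial variable, about p^(-t|S|) as long as t|S| is small compared with n,
   and the sum over S is then about exp(n p^(1-t)) - 1, which vanishes in the
   limit exactly when t - log_p n -> oo.  The larger S contribute exponentially
   little, provided t^2 = o(n), which is arranged by capping t. *)
Require Import Defs.
From HB Require Import structures.
From mathcomp Require Import all_boot all_order all_algebra all_fingroup.
From mathcomp Require Import lra.
Import Order.TTheory GRing.Theory Num.Theory.
Local Open Scope ring_scope.
Set Implicit Arguments.
Unset Strict Implicit.
Unset Printing Implicit Defensive.

(** * Permutations mapping one set off another *)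

Section PermAvoid.
Variable T : finType.
Implicit Types (J S : {set T}) (s : {perm T}).

Definition avoiding J S : {set {perm T}} :=
  [set s : {perm T} | [forall x in J, s x \notin S]]%SET.

Lemma avoidingP J S s :
  reflect {in J, forall x, s x \notin S} (s \in avoiding J S).
Proof. by rewrite inE; apply: forall_inP. Qed.

(** A permutation maps [J] off [S] exactly when its inverse maps [S] off [J]. *)
Lemma avoidingC J S : #|avoiding J S| = #|avoiding S J|.
Proof.
suff le J' S' : (#|avoiding J' S'| <= #|avoiding S' J'|)%N.
  by apply/eqP; rewrite eqn_leq !le.
rewrite -(card_imset _ (@invg_inj {perm T})); apply: subset_leq_card.
apply/subsetP => _ /imsetP[s /avoidingP sJ ->]; apply/avoidingP => x xS.
by apply/negP => /sJ; rewrite permKV xS.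
Qed.

(* Composing with the transposition of [s x] and [z], for [z] in [S], shows
   that [s x] falls in [S] for a proportion at least #|S|/#|T| of [s]. *)
Lemma avoiding_setU1 J S x : x \notin J ->
  (#|avoiding (x |: J)%SET S| * #|T| <= #|avoiding J S| * (#|T| - #|S|))%N.
Proof.
move=> xJ; set A := avoiding J S; set B := [set s in A | s x \in S]%SET.
have BA : B \subset A by apply/subsetP => s; rewrite inE => /andP[].
have -> : avoiding (x |: J)%SET S = (A :\: B)%SET.
  apply/setP => s; rewrite in_setD [s \in B]inE; apply/avoidingP/idP.
    move=> sJ; have sA : s \in A.
      by apply/avoidingP => y yJ; apply: sJ; rewrite inE yJ orbT.
    by rewrite sA andbT /= sJ // setU11.
  case/andP=> + sA; rewrite sA /= => sx y; rewrite !inE => /orP[/eqP->//|yJ].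
  by move/avoidingP: sA; apply.
rewrite cardsD (setIidPr BA) mulnBl mulnBr leq_sub2l //.
(* [h] sends pairs from [A] and [S] to pairs from [B] and [T]. Its second component remembers [s x],
   so the transposition can be undone. *)
pose h (u : {perm T} * T) := ((u.1 * tperm (u.1 x) u.2)%g, u.1 x).
have h_inj : injective h.
  move=> [s z] [s' z'] [/= e exx].
  have ez : z = z'.
    by have := congr1 (fun f : {perm T} => f x) e; rewrite !permM !tpermL.
  by move: e; rewrite exx ez => /mulIg ->.
rewrite -cardsX -cardsT -cardsX -(card_imset _ h_inj) subset_leq_card //.
apply/subsetP => _ /imsetP[[s z] /setXP[/= /avoidingP sA zS] ->].
apply/setXP; split; rewrite ?inE //=; apply/andP; split; last first.
  by rewrite permM tpermL.
apply/forall_inP => y yJ; rewrite permM tpermD ?sA //.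
  by apply: contra xJ => /eqP/perm_inj->.
by apply: contraTneq zS => ->; rewrite sA.
Qed.

(** Starting from all permutations, each point of [J] costs a factor [1 - #|S| / #|T|]; the
    denominators are cleared. *)
Lemma card_avoiding_le J S :
  (#|avoiding J S| * #|T| ^ #|J| <= (#|T| - #|S|) ^ #|J| * #|T|`!)%N.
Proof.
move Jm : #|J| => m; elim: m J Jm => [|m IH] J Jm.
  rewrite !expn0 muln1 mul1n -cardsT -card_perm subset_leq_card //.
  by apply/subsetP => s _; apply/subsetP => x; rewrite inE.
have [x xJ] : exists x, x \in J by apply/card_gt0P; rewrite Jm.
have Jx : #|(J :\ x)%SET| = m by have := cardsD1 x J; rewrite xJ Jm => -[].
have := @avoiding_setU1 (J :\ x)%SET S x; rewrite setD11 => /(_ isT).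
rewrite setD1K // => le1; rewrite !expnS mulnA.
apply: leq_trans (leq_mul le1 (leqnn _)) _.
by rewrite -mulnA mulnCA -mulnA leq_mul2l IH ?orbT.
Qed.

End PermAvoid.

(** * Binomial sums over subsets *)

Section SubsetSums.
Variables (R : comNzRingType) (T : finType).
Implicit Types A J : {set T}.

Lemma sum_set_expr2 (x y : R) :
  \sum_(J : {set T}) x ^+ #|J| * y ^+ (#|T| - #|J|) = (x + y) ^+ #|T|.
Proof.
rewrite -[RHS]prodr_const bigA_distr; apply: eq_bigr => J _.
rewrite big_if /= !prodr_const; congr (_ ^+ _ * _ ^+ _).
by rewrite -(cardsC J) addKn; apply: eq_card => i; rewrite !inE.
Qed.

Lemma sum_subset_expr A (x : R) :
  (* The product of the [F i + 1] below, with [F] vanishing off [A], expands over the subsets of [A]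
     only. *)
  \sum_(J : {set T} | J \subset A) x ^+ #|J| = (1 + x) ^+ #|A|.
Proof.
pose F i := if i \in A then x else 0.
transitivity (\prod_i (F i + 1)); last first.
  rewrite (bigID (mem A)) /= [X in _ * X]big1 ?mulr1 => [|i iA].
    rewrite -prodr_const; apply: eq_bigr => i iA.
    by rewrite /F iA addrC.
  by rewrite /F (negbTE iA) add0r.
rewrite bigA_distr big_mkcond; apply: eq_bigr => J _ /=.
case: ifPn => [JA|/subsetPn[i iJ iA]]; last first.
  by rewrite (bigD1 i) //= iJ /F (negbTE iA) mul0r.
rewrite big_if /= [X in _ * X]big1 // mulr1 -prodr_const.
by apply: eq_bigr => i iJ; rewrite /F (subsetP JA).
Qed.

Lemma sum_set_expr (x : R) : \sum_(J : {set T}) x ^+ #|J| = (1 + x) ^+ #|T|.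
Proof.
rewrite -cardsT -sum_subset_expr; apply: eq_bigl => J.
by rewrite subsetT.
Qed.

End SubsetSums.

Lemma exists_le_average (R : realDomainType) (I : finType) (i0 : I)
    (F : I -> R) (c : R) : \sum_i F i <= c *+ #|I| -> exists i, F i <= c.
Proof.
move=> le; apply/existsP; apply: contraTT le.
rewrite negb_exists => /forallP F_gt.
rewrite -ltNge -sumr_const; apply: ltr_sum.
  by apply/hasP; exists i0; rewrite ?mem_index_enum.
by move=> i _; rewrite ltNge F_gt.
Qed.

(** * The excess and its average over random permutations *)

Section Sparsity.
Variables (R : realFieldType) (n t : nat) (q : R).
Hypothesis q_gt1 : 1 < q.
Implicit Types (sigma : 'I_n -> {set 'I_n}) (S J : {set 'I_n}).

Definition columns_hit sigma S : {set 'I_n} :=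
  [set j | ~~ [disjoint sigma j & S]].

(** Values [f k j] that coincide for different [k] make the set smaller than [t]; this is harmless,
    as only an upper bound on its size is wanted. *)
Definition perm_support (f : {ffun 'I_t -> {perm 'I_n}}) (j : 'I_n) :
  {set 'I_n} := [set f k j | k : 'I_t].

Definition excess sigma : R := q ^- n *
  \sum_(S : {set 'I_n} | S != set0)
  \sum_(J : {set 'I_n} | (J != set0) && (J \subset ~: columns_hit sigma S))
     (q - 1) ^+ #|S| * (q - 1) ^+ #|J|.

(** The probability that a uniform permutation maps [J] off [S]. *)
Definition avoiding_freq J S : R := #|avoiding J S|%:R / n`!%:R.

Lemma excess_ge0 sigma : 0 <= excess sigma.
Proof.
have q1 : 0 <= q - 1 by rewrite subr_ge0 ltW.
apply: mulr_ge0; first by rewrite invr_ge0 exprn_ge0 // ltW // (lt_trans ltr01).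
by do 2![apply: sumr_ge0 => ? _]; rewrite mulr_ge0 ?exprn_ge0.
Qed.

(** If [S] hits h columns, the sum of [(q - 1) ^+ #|J|] over all sets [J] of missed columns is
    q^(n-h). Empty [J] give [1 - q ^- n] in total, and the other [J] give the excess. *)
Lemma sum_columns_hit sigma :
  \sum_(S : {set 'I_n} | S != set0) (q - 1) ^+ #|S| * q ^- #|columns_hit sigma S|
  = 1 - q ^- n + excess sigma.
Proof.
have q0 : q != 0 by rewrite gt_eqF // (lt_trans ltr01).
have sumS : \sum_(S : {set 'I_n} | S != set0) (q - 1) ^+ #|S| = q ^+ n - 1.
  have := @sum_set_expr R 'I_n (q - 1); rewrite (bigD1 set0) //= cards0 expr0.
  by rewrite card_ord [1 + (q - 1)]addrC subrK => <-; rewrite [RHS]addrC addKr.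
have -> : 1 - q ^- n = q ^- n * (q ^+ n - 1).
  by rewrite mulrBr mulVf ?mulr1 // expf_neq0.
rewrite -sumS -mulrDr -big_split mulr_sumr; apply: eq_bigr => S _ /=.
rewrite -mulr_sumr -{2}[(q - 1) ^+ _]mulr1 -mulrDr mulrCA; congr (_ * _).
have := @sum_subset_expr R 'I_n (~: columns_hit sigma S) (q - 1).
rewrite (bigD1 set0) ?sub0set //= cards0 expr0 [1 + (q - 1)]addrC subrK.
under eq_bigl do rewrite andbC.
move=> ->; have /(congr1 (GRing.exp q)) := cardsC (columns_hit sigma S).
by rewrite card_ord exprD => <-; rewrite invfM -mulrA mulVf ?mulr1 ?expf_neq0.
Qed.

(** For fixed [J] and [S] the suitable tuples [f] thus form a product set with [#|avoiding J S| ^ t]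
    elements. *)
Lemma subset_columns_missed (f : {ffun 'I_t -> {perm 'I_n}}) S J :
  (J \subset ~: columns_hit (perm_support f) S)
    = (f \in ffun_on (mem (avoiding J S))).
Proof.
apply/subsetP/ffun_onP => [JS k|fJS j jJ].
  apply/avoidingP => j /JS; rewrite !inE negbK => /disjointFr-> //.
  by apply/imsetP; exists k.
rewrite !inE negbK disjoints_subset; apply/subsetP => _ /imsetP[k _ ->].
by rewrite inE; have /avoidingP := fJS k; apply.
Qed.

Lemma avoiding_freq_ge0 J S : 0 <= avoiding_freq J S.
Proof. by rewrite divr_ge0. Qed.

Lemma avoiding_freqC J S : avoiding_freq J S = avoiding_freq S J.
Proof. by rewrite /avoiding_freq avoidingC. Qed.

Lemma avoiding_freq_le J S : (0 < n)%N ->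
  avoiding_freq J S <= (1 - #|S|%:R / n%:R) ^+ #|J|.
Proof.
move=> n_gt0; have Sn : (#|S| <= n)%N by rewrite -[leqRHS]card_ord max_card.
have n0 : n%:R != 0 :> R by rewrite pnatr_eq0 -lt0n.
have -> : 1 - #|S|%:R / n%:R = (n - #|S|)%:R / n%:R :> R.
  by rewrite natrB // mulrBl divff.
rewrite expr_div_n ler_pdivrMr ?ltr0n ?fact_gt0 // mulrAC.
rewrite ler_pdivlMr ?exprn_gt0 ?ltr0n // -!natrX -!natrM ler_nat.
by have := card_avoiding_le J S; rewrite card_ord.
Qed.

(** The bound is the mean of the excess over all [t]-tuples of permutations; independence of the
    components gives the [t]-th power. *)
Lemma exists_perm_support : exists f : {ffun 'I_t -> {perm 'I_n}},
  excess (perm_support f) <= q ^- n *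
    \sum_(S : {set 'I_n} | S != set0) \sum_(J : {set 'I_n} | J != set0)
      (q - 1) ^+ #|S| * (q - 1) ^+ #|J| * avoiding_freq J S ^+ t.
Proof.
apply: exists_le_average; first exact: [ffun=> 1%g].
rewrite -mulr_sumr -mulrnAr ler_wpM2l //.
  by rewrite invr_ge0 exprn_ge0 // ltW // (lt_trans ltr01).
rewrite exchange_big -sumrMnl ler_sum //= => S _.
under eq_bigr do rewrite big_mkcondr.
rewrite exchange_big -sumrMnl ler_sum //= => J _.
rewrite -big_mkcond (eq_bigl _ _ (fun f => subset_columns_missed f S J)).
rewrite sumr_const card_ffun_on !card_ord /avoiding_freq expr_div_n card_ffun.
rewrite card_ord card_Sn -[leLHS]mulr_natr -[leRHS]mulr_natr -[leRHS]mulrA.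
by rewrite !natrX divfK ?expf_neq0 ?pnatr_eq0 -?lt0n ?fact_gt0.
Qed.

End Sparsity.

(** * Counting supported matrices modulo p that a given row vector kills *)

Section SupportedMatrices.
Variable p : nat.
Hypothesis p_prime : prime p.
Let p_gt1 : (1 < p)%N. Proof. exact: prime_gt1. Qed.
Let card_Zp_p : #|'Z_p| = p. Proof. by rewrite card_ord Zp_cast. Qed.

Lemma Zp_unit_neq0 (a : 'Z_p) : a != 0 -> a \is a GRing.unit.
Proof.
move=> a0; rewrite -[a]natr_Zp unitZpE // prime_coprime //.
apply: contra a0 => p_a; rewrite -[a]natr_Zp; apply/eqP.
by case/dvdnP: p_a => k ->; rewrite natrM pchar_Zp // mulr0.
Qed.

Variable n : nat.
Implicit Types (phi : 'rV['Z_p]_n) (sigma : 'I_n -> {set 'I_n}).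
Implicit Types (S : {set 'I_n}) (c : {ffun 'I_n -> 'Z_p}).

Definition row_support phi : {set 'I_n} := [set i | phi 0 i != 0].

Definition supported_fun S c := [forall i, (i \notin S) ==> (c i == 0)].

Definition supported_mx sigma (A : 'M['Z_p]_n) :=
  [forall j, forall i, (i \notin sigma j) ==> (A i j == 0)].

Lemma card_supported_fun S : #|[set c | supported_fun S c]| = (p ^ #|S|)%N.
Proof.
rewrite -[p in RHS]card_Zp_p -(card_pffun_on (0 : 'Z_p)) cardsE; apply: eq_card => c.
rewrite !inE; apply/forallP/pffun_onP => [cS|[/subsetP cS _] i].
  split=> //; apply/subsetP => i; rewrite unfold_in; apply: contraR => iS.
  by have := cS i; rewrite iS.
apply/implyP; apply: contraR => ci; apply: cS; by rewrite unfold_in.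
Qed.

Definition supported_kernel phi S :=
  [set c | supported_fun S c & \sum_i phi 0 i * c i == 0].

(** The linear condition is vacuous when [S] misses the support of [phi]. Otherwise it has a unit
    coefficient at some point of [S] and divides the count by [p]. *)
Lemma card_supported_kernel phi S :
  (#|supported_kernel phi S|
     * p ^ (~~ [disjoint S & row_support phi]) = p ^ #|S|)%N.
Proof.
rewrite -card_supported_fun; case: (boolP [disjoint _ & _]) => [dis|].
  rewrite expn0 muln1; apply: eq_card => c; rewrite !inE.
  case: (boolP (supported_fun S c)) => //= /forallP cS; apply/eqP/big1 => i _.
  have [iS|iS] := boolP (i \in S); last by rewrite (eqP (implyP (cS i) iS)) mulr0.
  have := disjointFr dis iS; rewrite inE => /negbFE/eqP ->.
  by rewrite mul0r.
rewrite expn1 -setI_eq0 => /set0Pn[i0]; rewrite !inE => /andP[i0S].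
move/Zp_unit_neq0 => u; set K := supported_kernel phi S.
(* Shifting the coordinate [i0] by any residue will put kernel elements paired with residues in
   bijection with all functions supported on [S]. *)
pose h (u : {ffun 'I_n -> 'Z_p} * 'Z_p) : {ffun 'I_n -> 'Z_p} :=
  [ffun i => u.1 i + (i == i0)%:R * u.2].
have sum_h c a : \sum_i phi 0 i * h (c, a) i
    = \sum_i phi 0 i * c i + phi 0 i0 * a.
  under eq_bigr do rewrite ffunE mulrDr.
  rewrite big_split /=; congr (_ + _).
  rewrite (bigD1 i0) //= eqxx mul1r big1 ?addr0 // => i /negPf ->.
  by rewrite mul0r mulr0.
have h_supp c a : supported_fun S (h (c, a)) = supported_fun S c.
  apply: eq_forallb => i; rewrite ffunE; case: (i =P i0) => [->|_]; first
    by rewrite i0S.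
  by rewrite mul0r addr0.
have h_inj : {in setX K [set: 'Z_p] &, injective h}.
  move=> [c a] [c' a'] /setXP[/= cK _] /setXP[/= c'K _] e.
  move: cK c'K; rewrite !inE => /andP[_ /eqP c0] /andP[_ /eqP c'0].
  have ea : a = a'.
    have := sum_h c a; rewrite e sum_h c0 c'0 !add0r => /(mulrI u) //.
  rewrite -ea in e *; congr pair; apply/ffunP => i.
  by move/ffunP/(_ i): e; rewrite !ffunE => /addIr.
rewrite -[X in (_ * X)%N]card_Zp_p -[X in (_ * X)%N]cardsT -cardsX.
rewrite -(card_in_imset h_inj); apply: eq_card => c; rewrite [RHS]inE.
apply/imsetP/idP => [[[c' a]] /setXP[]|cS].
  by rewrite !inE => /andP[c'S _] _ ->; rewrite h_supp.
(* The one shift at [i0] whose removal brings [c] into the kernel. *)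
pose a := (phi 0 i0)^-1 * (\sum_i phi 0 i * c i).
exists (h (c, - a), a); last first.
  by apply/ffunP => i; rewrite !ffunE /= mulrN subrK.
apply/setXP; split; rewrite inE //= h_supp cS sum_h mulrN /a mulVKr ?subrr //.
Qed.

Definition supported_mx_kernel phi sigma :=
  [set A | supported_mx sigma A & phi *m A == 0].

(** The condition [phi *m A == 0] separates into one condition per column, so the counts of
    [card_supported_kernel] multiply. *)
Lemma card_supported_mx_kernel phi sigma :
  (#|supported_mx_kernel phi sigma|
     * p ^ #|columns_hit sigma (row_support phi)|
   = p ^ (\sum_j #|sigma j|))%N.
Proof.
pose K j := supported_kernel phi (sigma j).
pose h (A : 'M['Z_p]_n) : {ffun 'I_n -> {ffun 'I_n -> 'Z_p}} :=
  [ffun j => [ffun i => A i j]].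
pose g (f : {ffun 'I_n -> {ffun 'I_n -> 'Z_p}}) : 'M['Z_p]_n :=
  \matrix_(i, j) f j i.
have hK : cancel h g by move=> A; apply/matrixP => i j; rewrite mxE !ffunE.
have gK : cancel g h.
  by move=> f; apply/ffunP => j; apply/ffunP => i; rewrite !ffunE mxE.
have -> : #|supported_mx_kernel phi sigma| = #|family (fun j => mem (K j))|.
  rewrite -(card_imset _ (can_inj hK)); apply: eq_card => f.
  rewrite -[f in LHS]gK mem_imset; last exact: can_inj hK.
  rewrite inE; apply/andP/familyP => [[/forallP gS /eqP g0] j|fK].
    rewrite inE; apply/andP; split.
      by have /forallP gSj := gS j; apply/forallP => i; have := gSj i; rewrite mxE.
    move/rowP/(_ j): g0; rewrite !mxE => g0; apply/eqP; rewrite -[RHS]g0.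
    by apply: eq_bigr => i _; rewrite mxE.
  split.
    apply/forallP => j; have := fK j; rewrite inE => /andP[/forallP fS _].
    by apply/forallP => i; have := fS i; rewrite mxE.
  apply/eqP/rowP => j; have := fK j; rewrite inE => /andP[_ /eqP f0].
  by rewrite !mxE -[RHS]f0; apply: eq_bigr => i _; rewrite mxE.
rewrite card_family foldrE big_map big_enum /= -sum1_card expn_sum.
rewrite expn_sum [X in (_ * X)%N]big_mkcond -big_split /=; apply: eq_bigr => j _.
rewrite -(card_supported_kernel phi (sigma j)); congr (_ * _)%N.
by rewrite inE; case: ifP.
Qed.

(** Exactly [p.-1 ^ #|S|] row vectors have support [S]: one nonzero residue is chosen at each point
    of [S]. *)
Lemma sum_row_support (V : nmodType) (F : {set 'I_n} -> V) :
  \sum_(phi : 'rV['Z_p]_n | phi != 0) F (row_support phi) =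
  \sum_(S : {set 'I_n} | S != set0) F S *+ p.-1 ^ #|S|.
Proof.
have supp0 phi : (row_support phi != set0) = (phi != 0).
  apply/set0Pn/rV0Pn => [[i]|[i phi_i]]; first by rewrite inE; exists i.
  by exists i; rewrite inE.
rewrite (partition_big row_support (fun S => S != set0)) /=; last first.
  by move=> phi; rewrite supp0.
apply: eq_bigr => S S0.
transitivity (\sum_(phi | row_support phi == S) F S).
  apply: eq_big => [phi|phi /andP[_ /eqP-> //]].
  by case: (row_support phi =P S) => [e|]; rewrite ?andbF // andbT -supp0 e.
rewrite sumr_const; congr (_ *+ _).
have <- : #|predC1 (0 : 'Z_p)| = p.-1.
  by rewrite cardC1 card_Zp_p.
rewrite -(card_pffun_on (0 : 'Z_p)).
pose h (f : {ffun 'I_n -> 'Z_p}) : 'rV['Z_p]_n := \row_i f i.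
have h_inj : injective h.
  by move=> f f' /rowP e; apply/ffunP => i; have := e i; rewrite !mxE.
rewrite -(card_imset _ h_inj); apply: eq_card => phi.
transitivity (row_support phi == S); first by [].
apply/eqP/imsetP => [phiS|[f /pffun_onP[/subsetP fS f0] ->]].
  exists [ffun i => phi 0 i]; last by apply/rowP => i; rewrite !mxE ffunE.
  apply/pffun_onP; split.
    by apply/subsetP => i; rewrite inE ffunE -phiS inE.
  by move=> _ /imageP[i + ->]; rewrite -phiS !inE ffunE.
apply/setP => i; rewrite inE mxE; apply/idP/idP => [fi|iS].
  by apply: fS; rewrite unfold_in.
by apply: (f0 (f i)); apply: image_f.
Qed.

End SupportedMatrices.

From mathcomp Require Import generic_quotient finmap.
From mathcomp Require Import all_classical all_reals all_analysis.
From mathcomp Require Import measurable_realfun.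
Import numFieldNormedType.Exports.
Local Open Scope classical_set_scope.
Local Open Scope quotient_scope.

(** * Bounding the average excess according to the size of S *)

Section AverageExcess.
Variables (R : realType) (n t : nat) (q : R).
Hypotheses (q_ge2 : 2 <= q) (n_gt0 : (0 < n)%N) (t_gt0 : (0 < t)%N).
Implicit Types S J : {set 'I_n}.

Let q_gt0 : 0 < q. Proof. exact: lt_le_trans q_ge2. Qed.
Let q_gt1 : 1 < q. Proof. by apply: lt_le_trans q_ge2; rewrite ltr1n. Qed.
Let q1_ge0 : 0 <= q - 1. Proof. by rewrite subr_ge0 ltW. Qed.
Let qV_gt0 : 0 < q^-1. Proof. by rewrite invr_gt0. Qed.
Let N_gt0 : 0 < n%:R :> R. Proof. by rewrite ltr0n. Qed.
Let t_ge1 : 1 <= t%:R :> R. Proof. by rewrite ler1n. Qed.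

Let card_ratio_le1 S : #|S|%:R / n%:R <= 1 :> R.
Proof.
by rewrite ler_pdivrMr // mul1r ler_nat -[leqRHS]card_ord max_card.
Qed.

Lemma expr1Dx_le_expR (x : R) m : 0 <= 1 + x -> (1 + x) ^+ m <= expR (m%:R * x).
Proof. by move=> x0; rewrite expRM_natl lerXn2r ?nnegrE ?expR_ge0 ?expR_ge1Dx. Qed.

(** The [m]-th moment of 1 - B/n, where B is binomial with [n] trials and success probability
    [1 - q^-1]; the mean of 1 - B/n is [q^-1]. *)
Definition moment m : R := q ^- n *
  \sum_(J : {set 'I_n}) (q - 1) ^+ #|J| * (1 - #|J|%:R / n%:R) ^+ m.

Lemma moment0 : moment 0 = 1.
Proof.
rewrite /moment; under eq_bigr do rewrite expr0 mulr1.
rewrite sum_set_expr card_ord [1 + _]addrC subrK mulVf //.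
by rewrite expf_neq0 // gt_eqF.
Qed.

Lemma moment_ge0 m : 0 <= moment m.
Proof.
rewrite mulr_ge0 ?invr_ge0 ?exprn_ge0 ?(ltW q_gt0) // sumr_ge0 // => J _.
by rewrite mulr_ge0 ?exprn_ge0 // subr_ge0.
Qed.

Lemma moment_le m k : (m <= k)%N -> moment k <= moment m.
Proof.
move=> mk; rewrite /moment ler_wpM2l ?invr_ge0 ?exprn_ge0 ?(ltW q_gt0) //.
rewrite ler_sum // => J _.
by rewrite ler_wpM2l ?exprn_ge0 // ler_wiXn2l ?subr_ge0 ?card_ratio_le1.
Qed.

(** From [expR (- x) >= 1 - x], since (1 - x)(1 + x + 2x^2) = 1 + x^2(1 - 2x) is at least 1 in this
    range. *)
Lemma expR_le_quadratic (x : R) : 0 <= x <= 2^-1 ->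
  expR x <= 1 + x + 2 * x ^+ 2.
Proof.
move=> /andP[x0 x1]; have h : 0 < 1 - x by lra.
have /le_trans : expR x <= (1 - x)^-1.
  rewrite -[x in expR x]opprK expRN lef_pV2 ?posrE ?expR_gt0 //.
  exact: expR_ge1Dx.
apply; rewrite -[leLHS]mul1r ler_pdivrMr //; nra.
Qed.

(* The tangent line bound [q x <= expR (q x - 1)] turns the moment into a
   binomial sum. *)
Lemma moment_le_expR m : 2 * q * m%:R <= n%:R ->
  moment m <= q ^- m * expR (2 * q * m%:R ^+ 2 / n%:R).
Proof.
move=> m_le; set lam := q * m%:R / n%:R.
have lam_bnd : 0 <= lam <= 2^-1.
  apply/andP; split; first by rewrite /lam divr_ge0 ?mulr_ge0 // ltW.
  by rewrite /lam ler_pdivrMr //; lra.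
have tangent J : (1 - #|J|%:R / n%:R) ^+ m <=
    q ^- m * expR (- m%:R) * expR lam ^+ (n - #|J|).
  have Jn : (#|J| <= n)%N by rewrite -[leqRHS]card_ord max_card.
  set x := 1 - _; have x0 : 0 <= x by rewrite subr_ge0 card_ratio_le1.
  have -> : q ^- m * expR (- m%:R) * expR lam ^+ (n - #|J|)
      = (q^-1 * expR (q * x - 1)) ^+ m.
    rewrite exprMn exprVn -!expRM_natl -mulrA -expRD; congr (_ * expR _).
    rewrite natrB // /lam /x.
    have : n%:R / n%:R = 1 :> R by rewrite divff ?gt_eqF.
    move: (n%:R : R) (m%:R : R) (#|J|%:R : R) (n%:R^-1 : R) => n' m' j v e.
    have -> : (n' - j) * (q * m' * v) = q * m' * (n' * v) - q * m' * (j * v).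
      by lra.
    by rewrite e; lra.
  rewrite lerXn2r ?nnegrE //; first by rewrite mulr_ge0 ?expR_ge0 // ltW.
  rewrite mulrC ler_pdivlMr // mulrC.
  by apply: le_trans (expR_ge1Dx _); lra.
apply: (@le_trans _ _ (q ^- n * (q ^- m * expR (- m%:R) *
    (q - 1 + expR lam) ^+ n))).
  rewrite ler_wpM2l ?invr_ge0 ?exprn_ge0 ?(ltW q_gt0) //.
  have := @sum_set_expr2 R 'I_n (q - 1) (expR lam); rewrite card_ord => <-.
  rewrite mulr_sumr ler_sum // => J _; rewrite mulrCA.
  by rewrite ler_wpM2l ?exprn_ge0.
rewrite mulrCA -[leLHS]mulrA ler_wpM2l ?invr_ge0 ?exprn_ge0 ?(ltW q_gt0) //.
rewrite -exprVn -exprMn.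
have -> : q^-1 * (q - 1 + expR lam) = 1 + (expR lam - 1) / q.
  have : q^-1 * q = 1 by rewrite mulVf ?gt_eqF.
  by move: (expR lam) q^-1 => ? ?; lra.
(* The linear part [n * lam / q] equals [m] and cancels [expR (- m%:R)]; the quadratic part is the
   remaining 2qm^2/n. *)
apply: (@le_trans _ _ (expR (- m%:R) * expR (n%:R * ((lam + 2 * lam ^+ 2) / q)))).
  rewrite ler_wpM2l ?expR_ge0 //; apply: (le_trans (expr1Dx_le_expR _ _)).
    rewrite addr_ge0 // divr_ge0 ?(ltW q_gt0) // subr_ge0 -expR0 ler_expR.
    by case/andP: lam_bnd.
  rewrite ler_expR ler_wpM2l // ler_wpM2r ?(ltW qV_gt0) // lerBlDl addrA.
  exact: expR_le_quadratic.
rewrite -expRD ler_expR /lam.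
have : n%:R / n%:R = 1 :> R by rewrite divff ?gt_eqF.
have : q * q^-1 = 1 by rewrite divff ?gt_eqF.
move: (n%:R : R) (m%:R : R) q^-1 (n%:R^-1 : R) => n' m' w v e1 e2.
have -> : n' * ((q * m' * v + 2 * (q * m' * v) ^+ 2) * w)
  = (q * w) * (n' * v) * m' + 2 * (q * w) * (n' * v) * q * m' ^+ 2 * v by lra.
by rewrite e1 e2; lra.
Qed.

(** The contribution of [S] to the average, with [J] restricted to sets at least as large as [S]. *)
Definition row_weight S : R := (q - 1) ^+ #|S| * (q ^- n *
  \sum_(J : {set 'I_n} | (#|S| <= #|J|)%N)
    (q - 1) ^+ #|J| * avoiding_freq R J S ^+ t).

(** With the roles of [J] and [S] exchanged, the frequency is at most [(1 - #|J| / n) ^+ #|S|], and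
    its [t]-th power has exponent [#|S| * t]. *)
Lemma row_weight_le_moment S m : (m <= #|S| * t)%N ->
  row_weight S <= (q - 1) ^+ #|S| * moment m.
Proof.
move=> /moment_le m_le; rewrite /row_weight ler_wpM2l ?exprn_ge0 //.
apply: le_trans m_le.
rewrite /moment ler_wpM2l ?invr_ge0 ?exprn_ge0 ?(ltW q_gt0) //.
rewrite big_mkcond ler_sum // => J _.
case: ifP => _; last by rewrite mulr_ge0 ?exprn_ge0 // subr_ge0.
rewrite ler_wpM2l ?exprn_ge0 // exprM avoiding_freqC.
by rewrite lerXn2r ?nnegrE ?avoiding_freq_ge0 ?exprn_ge0 ?avoiding_freq_le ?subr_ge0.
Qed.

Let q1_le S : (q - 1) ^+ #|S| <= q ^+ #|S|.
Proof. by rewrite lerXn2r ?nnegrE ?(ltW q_gt0) // gerDl lerN10. Qed.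

Let expR_card S : expR #|S|%:R = expR 1 ^+ #|S| :> R.
Proof. by rewrite -expRM_natl mulr1. Qed.

Let expr_cardM S : q ^- (#|S| * t) = (q ^- t) ^+ #|S|.
Proof. by rewrite mulnC exprM exprVn. Qed.

(** For small [S] the error exponent 2q(|S|t)^2/n of the moment bound is at most |S|. *)
Lemma row_weight_le1 S : 2 * q * #|S|%:R * t%:R ^+ 2 <= n%:R ->
  row_weight S <= (expR 1 * q * q ^- t) ^+ #|S|.
Proof.
move=> S_le; set s : R := #|S|%:R in S_le; have s0 : 0 <= s by [].
have qs0 : 0 <= 2 * q * s * t%:R by rewrite !mulr_ge0 // ltW.
apply: (le_trans (row_weight_le_moment (leqnn _))).
have -> : (expR 1 * q * q ^- t) ^+ #|S|
    = q ^+ #|S| * (q ^- (#|S| * t) * expR s).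
  by rewrite expR_card expr_cardM -!exprMn; congr (_ ^+ _); lra.
rewrite ler_pM ?exprn_ge0 ?q1_le //.
  exact: moment_ge0.
apply: (le_trans (moment_le_expR _)); rewrite natrM -/s.
  by apply: le_trans S_le; have := ler_wpM2l qs0 t_ge1; lra.
rewrite ler_wpM2l ?invr_ge0 ?exprn_ge0 ?(ltW q_gt0) // ler_expR.
rewrite ler_pdivrMr //.
have : s * (2 * q * s * t%:R ^+ 2) <= s * n%:R by rewrite ler_wpM2l.
lra.
Qed.

(** In this range the error exponent is at most |S|t/8. The lower bound on |S| makes e^|S|
    exp(-n/(2qt^2)) at least 1, and inserting this factor provides decay in n. *)
Lemma row_weight_le2 S : 16 * q * #|S|%:R * t%:R <= n%:R ->
  n%:R <= 2 * q * #|S|%:R * t%:R ^+ 2 ->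
  row_weight S <= (expR 1 * q * (expR 8^-1 / q) ^+ t) ^+ #|S| *
    expR (- (n%:R / (2 * q * t%:R ^+ 2))).
Proof.
move=> S_le S_ge; set s : R := #|S|%:R in S_le S_ge; have s0 : 0 <= s by [].
have qs0 : 0 <= q * s * t%:R by rewrite !mulr_ge0 // ltW.
apply: (le_trans (row_weight_le_moment (leqnn _))).
have -> : (expR 1 * q * (expR 8^-1 / q) ^+ t) ^+ #|S|
    = q ^+ #|S| * (q ^- (#|S| * t) * expR (s * t%:R / 8)) * expR s.
  have -> : expR (s * t%:R / 8) = (expR 8^-1 ^+ t) ^+ #|S|.
    by rewrite -!expRM_natl mulrA.
  rewrite expR_card expr_cardM.
  by rewrite -!exprMn; congr (_ ^+ _); rewrite exprMn exprVn; lra.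
rewrite -[leRHS]mulrA -expRD -[leLHS]mulr1.
rewrite ler_pM //.
- by rewrite mulr_ge0 ?exprn_ge0 ?moment_ge0.
- rewrite ler_pM ?exprn_ge0 ?q1_le ?moment_ge0 //.
  apply: (le_trans (moment_le_expR _)); rewrite natrM -/s; first by lra.
  rewrite ler_wpM2l ?invr_ge0 ?exprn_ge0 ?(ltW q_gt0) // ler_expR.
  rewrite ler_pdivrMr //.
  have : s * t%:R * (16 * q * s * t%:R) <= s * t%:R * n%:R.
    by rewrite ler_wpM2l // mulr_ge0.
  lra.
- rewrite -[leLHS]expR0 ler_expR subr_ge0 ler_pdivrMr -/s; first by lra.
  by rewrite !mulr_gt0 ?exprn_gt0 ?ltr0n.
Qed.

(* Here the power [#|S| * t] of [1 - j / n] exceeds [n / (16 q)], and lowering it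
   to that value already gives exponential decay in [n]. *)
Lemma row_weight_le3 S (e l : R) : 0 <= l -> n%:R <= 16 * q * #|S|%:R * t%:R ->
  #|S|%:R <= e * n%:R ->
  row_weight S <= (q * expR (- l)) ^+ #|S| *
    expR (l * e * n%:R + 3 / 8 - 3 * n%:R / (128 * q)).
Proof.
move=> l0 S_ge S_le; pose m := Num.truncn (n%:R / (16 * q)).
have q16 : 0 < 16 * q by rewrite mulr_gt0.
have nq0 : 0 <= n%:R / (16 * q) by rewrite divr_ge0 // ltW.
have /andP[m_le m_gt] : m%:R <= n%:R / (16 * q) < m.+1%:R by exact: truncn_itv.
have m_le' : 16 * q * m%:R <= n%:R by move: m_le; rewrite ler_pdivlMr //; lra.
have mS : (m <= #|S| * t)%N.
  rewrite -(ler_nat R) natrM; apply: le_trans m_le _.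
  by rewrite ler_pdivrMr //; lra.
apply: (le_trans (row_weight_le_moment mS)).
(* Three facts combine: [q ^- m] is at most e^(-m/2) because e^(1/2) <= 2 <= q, the error exponent
   is at most m/8, and m exceeds n/(16q) - 1. *)
have m_bound : moment m <= expR (3 / 8 - 3 * n%:R / (128 * q)).
  apply: (@le_trans _ _ (expR (- (m%:R / 2)) * expR (m%:R / 8))).
    apply: (le_trans (moment_le_expR _)).
      have : 0 <= q * m%:R by rewrite mulr_ge0 // ltW.
      lra.
    rewrite ler_pM ?invr_ge0 ?exprn_ge0 ?expR_ge0 ?(ltW q_gt0) //.
      rewrite expRN expRM_natl lef_pV2 ?posrE ?exprn_gt0 ?expR_gt0 //.
      rewrite lerXn2r ?nnegrE ?expR_ge0 ?(ltW q_gt0) //.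
      apply: le_trans q_ge2; apply: (le_trans (expR_le_quadratic _)); lra.
    rewrite ler_expR ler_pdivrMr //.
    have : m%:R * (16 * q * m%:R) <= m%:R * n%:R by rewrite ler_wpM2l.
    lra.
  rewrite -expRD ler_expR.
  have -> : 3 * n%:R / (128 * q) = 3 / 8 * (n%:R / (16 * q)).
    rewrite !invfM; lra.
  by move: m_gt; rewrite -natr1; lra.
(* The factor exp(l(en - |S|)) is inserted. It is at least 1 here, and it keeps the later sum over
   all [S] under control. *)
rewrite exprMn -[leRHS]mulrA ler_pM ?moment_ge0 ?exprn_ge0 ?q1_le //.
apply: (le_trans m_bound); rewrite -expRM_natl -expRD ler_expR.
have : l * #|S|%:R <= l * (e * n%:R) by rewrite ler_wpM2l.
lra.
Qed.

(** When |J| >= |S| >= en, the frequency is at most exp(-|S||J|/n), hence at most exp(-e^2 n). The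
    remaining average over [J] is at most [moment 0], which is 1. *)
Lemma row_weight_le4 S (e : R) : 0 <= e -> e * n%:R <= #|S|%:R ->
  row_weight S <= (q - 1) ^+ #|S| * expR (- (e ^+ 2 * n%:R)) ^+ t.
Proof.
move=> e0 S_ge; rewrite /row_weight ler_wpM2l ?exprn_ge0 //.
set E := expR _ ^+ t; rewrite -[leRHS]mul1r -[1 in leRHS]moment0 /moment -mulrA {}/E.
rewrite ler_wpM2l ?invr_ge0 ?exprn_ge0 ?(ltW q_gt0) //.
rewrite big_mkcond mulr_suml ler_sum // => J _; rewrite expr0 mulr1.
case: ifPn => [SJ|_]; last by rewrite mulr_ge0 ?exprn_ge0 ?expR_ge0.
rewrite ler_wpM2l ?exprn_ge0 // lerXn2r ?nnegrE ?expR_ge0 ?avoiding_freq_ge0 //.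
apply: (le_trans (avoiding_freq_le _ _ _ n_gt0)).
apply: (le_trans (expr1Dx_le_expR _ _)); first by rewrite subr_ge0.
rewrite ler_expR mulrN lerN2.
have {}SJ : #|S|%:R <= #|J|%:R :> R by rewrite ler_nat.
have eN : 0 <= e * n%:R by rewrite mulr_ge0.
rewrite mulrA ler_pdivlMr // [leLHS](_ : _ = e * n%:R * (e * n%:R)); last first.
  by lra.
by rewrite ler_pM // (le_trans S_ge).
Qed.

(** The summand is symmetric in [S] and [J], and one of the two sets is at least as large as the
    other; pairs of equal size are counted twice. *)
Lemma average_excess_le_row_weight :
  q ^- n * (\sum_(S : {set 'I_n} | S != finset.set0)
    \sum_(J : {set 'I_n} | J != finset.set0)
      (q - 1) ^+ #|S| * (q - 1) ^+ #|J| * avoiding_freq R J S ^+ t)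
  <= 2 * \sum_(S : {set 'I_n} | S != finset.set0) row_weight S.
Proof.
pose D S J := (q - 1) ^+ #|S| * (q - 1) ^+ #|J| * avoiding_freq R J S ^+ t.
have D_ge0 S J : 0 <= D S J.
  by rewrite !mulr_ge0 ?exprn_ge0 ?avoiding_freq_ge0.
have DC S J : D S J = D J S by rewrite /D avoiding_freqC [_ * (q - 1) ^+ _]mulrC.
set W := \sum_(S | _) row_weight S.
have -> : 2 * W = q ^- n *
    ((\sum_(S : {set 'I_n} | S != finset.set0)
    \sum_(J : {set 'I_n} | J != finset.set0)
       if (#|S| <= #|J|)%N then D S J else 0) +
     (\sum_(S : {set 'I_n} | S != finset.set0)
    \sum_(J : {set 'I_n} | J != finset.set0)
       if (#|J| <= #|S|)%N then D S J else 0)).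
  rewrite [X in _ + X]exchange_big /=.
  under [X in _ + X]eq_bigr => S _ do under eq_bigr => J _ do rewrite DC.
  rewrite -mulr2n -[in RHS]mulr_natl mulrCA; congr (_ * _).
  rewrite mulr_sumr; apply: eq_bigr => S S0.
  rewrite /row_weight mulrCA; congr (_ * _); rewrite -big_mkcondr mulr_sumr.
  apply: eq_big => [J|J _]; last by rewrite mulrA.
  case SJ: (_ <= _)%N; rewrite ?andbF // andbT.
  by rewrite -card_gt0 (leq_trans _ SJ) // card_gt0.
rewrite ler_wpM2l ?invr_ge0 ?exprn_ge0 ?(ltW q_gt0) //.
rewrite -big_split ler_sum // => S _ /=; rewrite -big_split ler_sum // => J _ /=.
rewrite -/(D S J).
by case: leqP => [_|/ltnW ->]; rewrite ?add0r // lerDl; case: ifP.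
Qed.

Let sum_powers (x : R) : 0 <= x ->
  \sum_(S : {set 'I_n}) x ^+ #|S| <= expR (n%:R * x).
Proof.
by move=> x0; rewrite sum_set_expr card_ord expr1Dx_le_expR // addr_ge0.
Qed.

(** The four terms come from the ranges of |S| separated by n/(2qt^2), n/(16qt) and en. In each, the
    sum of x^|S| is (1 + x)^n, at most exp(nx). *)
Lemma average_excess_le (e := (512 ^+ 2 * q ^+ 3)^-1) :
  q ^- n * (\sum_(S : {set 'I_n} | S != finset.set0)
    \sum_(J : {set 'I_n} | J != finset.set0)
      (q - 1) ^+ #|S| * (q - 1) ^+ #|J| * avoiding_freq R J S ^+ t)
  <= 2 * (expR (n%:R * (expR 1 * q * q ^- t)) - 1 +
          expR (n%:R * (expR 1 * q * (expR 8^-1 / q) ^+ t)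
                - n%:R / (2 * q * t%:R ^+ 2)) +
          expR (3 / 8 - 10 * n%:R / (512 * q)) +
          (q * expR (- (e ^+ 2 * t%:R))) ^+ n).
Proof.
apply: (le_trans average_excess_le_row_weight); rewrite ler_pM2l //.
(* Chosen so that [l * e] equals 1/(512q) and [q * expR (- l)] is at most 1/(512q). Together they
   use up only 2 of the 12 units n/(512q) of decay in [row_weight_le3]. *)
pose l := 512 * q ^+ 2.
have k_gt0 : 0 < 512 :> R by rewrite ltr0n.
have kq_gt0 : 0 < 512 * q := mulr_gt0 k_gt0 q_gt0.
have l0 : 0 < l := mulr_gt0 k_gt0 (exprn_gt0 2 q_gt0).
have eV_gt0 : 0 < 512 ^+ 2 * q ^+ 3 :=
  mulr_gt0 (exprn_gt0 2 k_gt0) (exprn_gt0 3 q_gt0).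
have e0 : 0 <= e by rewrite invr_ge0 ltW.
set x1 := expR 1 * q * q ^- t; set x2 := expR 1 * q * _ ^+ t.
have x1_ge0 : 0 <= x1 by rewrite !mulr_ge0 ?expR_ge0 ?invr_ge0 ?exprn_ge0 ?(ltW q_gt0).
have x2_ge0 : 0 <= x2.
  by rewrite !mulr_ge0 ?expR_ge0 ?exprn_ge0 ?mulr_ge0 ?expR_ge0
    ?(ltW q_gt0) ?(ltW qV_gt0).
pose x3 := q * expR (- l).
have x3_ge0 : 0 <= x3 by rewrite mulr_ge0 ?expR_ge0 ?(ltW q_gt0).
pose c2 := expR (- (n%:R / (2 * q * t%:R ^+ 2))).
pose c3 := expR (l * e * n%:R + 3 / 8 - 3 * n%:R / (128 * q)).
pose c4 := expR (- (e ^+ 2 * n%:R)) ^+ t.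
have T2_ge0 S : 0 <= x2 ^+ #|S| * c2 by rewrite mulr_ge0 ?exprn_ge0 ?expR_ge0.
have T3_ge0 S : 0 <= x3 ^+ #|S| * c3 by rewrite mulr_ge0 ?exprn_ge0 ?expR_ge0.
have T4_ge0 S : 0 <= (q - 1) ^+ #|S| * c4.
  by rewrite mulr_ge0 ?exprn_ge0 ?expR_ge0.
have T1_ge0 S : 0 <= x1 ^+ #|S| by rewrite exprn_ge0.
have weight_le S : row_weight S <=
    x1 ^+ #|S| + x2 ^+ #|S| * c2 + x3 ^+ #|S| * c3 + (q - 1) ^+ #|S| * c4.
  move: (T1_ge0 S) (T2_ge0 S) (T3_ge0 S) (T4_ge0 S) => *.
  have [/row_weight_le1|/ltW le2] := leP (2 * q * #|S|%:R * t%:R ^+ 2) n%:R.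
    by rewrite -/x1; lra.
  have [/row_weight_le2/(_ le2)|/ltW le3] := leP (16 * q * #|S|%:R * t%:R) n%:R.
    by rewrite -/x2 -/c2; lra.
  have [/(row_weight_le3 (ltW l0) le3)|/ltW] := leP #|S|%:R (e * n%:R).
    by rewrite -/x3 -/c3; lra.
  by move/(row_weight_le4 e0); rewrite -/c4; lra.
(* Omitting the empty set matters for the first range: its full sum is bounded by an exponential
   tending to 1, not to 0. *)
have sum_nonempty (x : R) : \sum_(S : {set 'I_n} | S != finset.set0) x ^+ #|S| =
    \sum_(S : {set 'I_n}) x ^+ #|S| - 1.
  by rewrite [in RHS](bigD1 finset.set0) //= cards0 expr0 addrC addrK.
have sum_le (x c : R) : 0 <= x -> 0 <= c ->
    \sum_(S : {set 'I_n} | S != finset.set0) x ^+ #|S| * c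
    <= \sum_(S : {set 'I_n}) x ^+ #|S| * c.
  move=> *; rewrite [leRHS](bigID (pred1 finset.set0)) /= lerDr.
  by apply: sumr_ge0 => S _; rewrite mulr_ge0 ?exprn_ge0.
apply: (le_trans (ler_sum _ (fun S _ => weight_le S))).
rewrite !big_split /=; apply: lerD; first apply: lerD; first apply: lerD.
- by rewrite sum_nonempty lerD2r sum_powers.
- apply: (le_trans (sum_le _ _ x2_ge0 (expR_ge0 _))).
  by rewrite -mulr_suml expRD ler_wpM2r ?expR_ge0 ?sum_powers.
- apply: (le_trans (sum_le _ _ x3_ge0 (expR_ge0 _))).
  rewrite -mulr_suml; apply: (@le_trans _ _ (expR (n%:R * x3) * c3)).
    by rewrite ler_wpM2r ?expR_ge0 ?sum_powers.
  rewrite -expRD ler_expR.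
  have x3_le : x3 <= (512 * q)^-1.
    rewrite /x3 expRN ler_pdivrMr ?expR_gt0 // (ler_pdivlMl _ _ kq_gt0).
    by have := expR_ge1Dx l; rewrite {1}/l; lra.
  have -> : l * e = (512 * q)^-1.
    rewrite /l /e -[RHS]mul1r; apply/eqP; rewrite eqr_div ?(lt0r_neq0 eV_gt0)
      ?(lt0r_neq0 kq_gt0) //.
    by apply/eqP; lra.
  have := ler_wpM2l (ltW N_gt0) x3_le.
  have -> : 3 * n%:R / (128 * q) = 12 * (n%:R * (512 * q)^-1) by rewrite !invfM; lra.
  lra.
- apply: (le_trans (sum_le _ _ q1_ge0 (exprn_ge0 _ (expR_ge0 _)))).
  rewrite -mulr_suml sum_set_expr card_ord [1 + _]addrC subrK exprMn.
  rewrite -!expRM_natl le_eqVlt; apply/orP; left; apply/eqP.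
  by congr (_ * expR _); lra.
Qed.

End AverageExcess.

(** Serves to count surjections, which are functions on the cokernel parametrized by a finite set of
    row vectors. *)
Lemma counting_image (R : realType) (T : finType) (U : choiceType)
    (A : {set T}) (f : T -> U) : {in A &, injective f} ->
  counting (f @` [set` A]) = (#|A|%:R : R)%:E.
Proof.
move=> f_inj; pose s := [seq f x | x <- enum A].
have -> : f @` [set` A] = [set` [fset y in s]%fset].
  apply/seteqP; split=> y /=; rewrite inE.
    by move=> [x xA <-]; rewrite map_f // mem_enum.
  by move=> /mapP[x]; rewrite mem_enum => xA ->; exists x.
rewrite /counting asboolT; last exact: finite_fset.
rewrite set_fsetK card_fseq undup_id ?size_map -?cardE //.
by rewrite map_inj_in_uniq ?enum_uniq // => x y; rewrite !mem_enum; exact: f_inj.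
Qed.

(** * Surjections from the cokernel as row vectors modulo p *)

Section Reduction.
Variable p : nat.
Hypothesis p_prime : prime p.
Let p_gt1 : (1 < p)%N. Proof. exact: prime_gt1. Qed.

(** Component 0 lives modulo [p ^ 1], which is convertible to [p]. *)
Definition reduction (x : padic p) : 'Z_p := x 0%N.

Fact reduction_zmod_morphism : zmod_morphism reduction.
Proof. by []. Qed.
Fact reduction_monoid_morphism : monoid_morphism reduction.
Proof. by []. Qed.

HB.instance Definition _ :=
  GRing.isZmodMorphism.Build (padic p) 'Z_p reduction reduction_zmod_morphism.
HB.instance Definition _ :=
  GRing.isMonoidMorphism.Build (padic p) 'Z_p reduction reduction_monoid_morphism.

Lemma padic_natE m k : (m%:R : padic p) k = m%:R.
Proof. by elim: m => // m IH; rewrite -!natr1 -IH. Qed.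

Lemma reduction_nat (a : 'Z_p) : reduction (a : nat)%:R = a.
Proof. by rewrite rmorph_nat natr_Zp. Qed.

Let p_exp_gt1 k : (1 < p ^ k.+1)%N.
Proof. by rewrite -(exp1n k.+1) ltn_exp2r. Qed.

Lemma padic_compat_mod (x : padic p) k :
  (x k : nat) = (x k.+1 %% p ^ k.+1)%N.
Proof. by rewrite -(padic_compat x k) val_Zp_nat. Qed.

Lemma padic_mod_p (x : padic p) k : (x k = x 0 %[mod p])%N.
Proof.
elim: k => // k <-; rewrite (padic_compat_mod x k).
by rewrite modn_dvdm // expnS dvdn_mulr.
Qed.

Lemma reduction_eq0 (x : padic p) :
  reduction x = 0 -> exists y, x = p%:R * y.
Proof.
move=> x0; have p_dvd k : (p %| x k)%N.
  by rewrite /dvdn padic_mod_p; move: x0; rewrite /reduction => ->; rewrite mod0n.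
(* Division by [p] loses one digit, so component [k] of the quotient is read from component [k.+1]
   of [x]. *)
pose r k : 'Z_(p ^ k.+1) := (x k.+1 %/ p)%:R.
have r_compat k : ((r k.+1 : nat)%:R : 'Z_(p ^ k.+1)) = r k.
  apply: val_inj; rewrite /r /= !val_Zp_nat //.
  rewrite modn_dvdm ?dvdn_exp2l // (padic_compat_mod x k.+1).
  (* Multiplying both residues and the modulus by [p] undoes the divisions and leaves the
     compatibility of [x]. *)
  apply/eqP; rewrite -(eqn_pmul2l (ltnW p_gt1)) !muln_modr -!expnS.
  rewrite [(p * (_ %/ p))%N]mulnC divnK //.
  rewrite [(p * (_ %/ p))%N]mulnC divnK ?modn_mod //.
  by rewrite -(padic_compat_mod x k.+1).
exists (Padic r_compat); apply: padicP => k.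
have -> : (p%:R * Padic r_compat : padic p) k = (p * (x k.+1 %/ p))%:R.
  rewrite natrM; congr (_ * _).
  exact: padic_natE.
by rewrite mulnC divnK // padic_compat.
Qed.

(** [f] kills the multiples of [p], and [x] differs from a natural number lifting its residue by
    such a multiple. *)
Lemma additive_padic_Zp (f : padic p -> 'Z_p) :
  {morph f : x y / x + y} -> forall x, f x = reduction x * f 1.
Proof.
move=> fD; have f0 : f 0 = 0 by apply: (addrI (f 0)); rewrite -fD !addr0.
have fMn x m : f (x *+ m) = f x *+ m.
  by elim: m => [|m IH]; rewrite ?mulr0n // !mulrS fD IH.
move=> x; have [|y] := @reduction_eq0 (x - (reduction x : nat)%:R).
  by rewrite rmorphB /= reduction_nat subrr.
move/eqP; rewrite subr_eq => /eqP {1}->; rewrite mulr_natl fD !fMn.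
by rewrite -mulr_natl pchar_Zp // mul0r add0r -[LHS]mulr_natl natr_Zp.
Qed.

Variables (n : nat) (M : 'M[padic p]_n).
Local Notation red := (map_mx reduction).
Implicit Types (phi : 'rV['Z_p]_n) (v : 'cV[padic p]_n).

(** This is independent of the chosen representative once [phi] kills [M] modulo p, which is when it
    is used. *)
Definition cok_functional phi (y : cok M) : 'Z_p := (phi *m red (repr y)) 0 0.

Definition left_kernel_nonzero : {set 'rV['Z_p]_n} :=
  [set phi | (phi != 0) && (phi *m red M == 0)]%SET.

Local Notation pr := (\pi_(cok M)).

Let prD : {morph pr : u v / u + v}.
Proof. exact: Quotient.pi_add. Qed.

Let pr0 : pr 0 = 0.
Proof. by apply: (addrI (pr 0)); rewrite -prD !addr0. Qed.

Lemma cok_functional_pi phi v : phi *m red M = 0 ->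
  cok_functional phi (pr v) = (phi *m red v) 0 0.
Proof.
move=> phiM; rewrite /cok_functional.
have : repr (pr v) - v \in @col_image p n M.
  by rewrite (@Quotient.idealrBE _ (@col_image p n M)) reprK.
move/asboolP => [w /eqP]; rewrite subr_eq => /eqP ->.
by rewrite map_mxD map_mxM mulmxDr mulmxA phiM mul0mx add0r.
Qed.

Lemma cok_functional_delta phi i : phi *m red M = 0 ->
  cok_functional phi (pr (delta_mx i 0)) = phi 0 i.
Proof.
move=> phiM; rewrite cok_functional_pi // mxE (bigD1 i) //= big1 ?addr0.
  by rewrite !mxE !eqxx rmorph1 mulr1.
by move=> j ji; rewrite !mxE (negbTE ji) rmorph0 mulr0.
Qed.

(** A nonzero entry of [phi] is a unit, which gives surjectivity. Conversely, an additive map is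
    determined by its values on the classes of the standard basis. *)
Lemma Sur_cokE :
  Sur (cok M) 'Z_p = cok_functional @` [set` left_kernel_nonzero].
Proof.
apply/seteqP; split => [f [fD f_surj]|_ [phi + <-]] /=; last first.
  rewrite /= finset.inE => /andP[/rV0Pn[i phi_i] /eqP phiM]; split.
    move=> x y; rewrite -[x]reprK -[y]reprK -prD !cok_functional_pi //.
    by rewrite map_mxD mulmxDr mxE.
  move=> c _; have [a aE] : exists a, a * phi 0 i = c.
    by exists (c / phi 0 i); rewrite divrK // Zp_unit_neq0.
  exists (pr ((a : nat)%:R *: delta_mx i 0)) => //.
  rewrite cok_functional_pi // map_mxZ -scalemxAr mxE /= reduction_nat.
  by rewrite -cok_functional_pi // cok_functional_delta.
pose phi : 'rV['Z_p]_n := \row_i f (pr (delta_mx i 0)).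
have f0 : f 0 = 0 by apply: (addrI (f 0)); rewrite -fD !addr0.
have fE v : f (pr v) = (phi *m red v) 0 0.
  rewrite [v in LHS]matrix_sum_delta.
  have f_sum : {morph (fun u => f (pr u)) : u w / u + w >-> u + w}.
    by move=> u w; rewrite prD fD.
  have fpr0 : f (pr 0) = 0 by rewrite pr0.
  rewrite (big_morph _ f_sum fpr0) mxE; apply: eq_bigr => i _.
  rewrite big_ord1 !mxE mulrC.
  pose g x := f (pr (x *: delta_mx i 0)).
  have gD : {morph g : x y / x + y} by move=> x y; rewrite /g scalerDl f_sum.
  by have := additive_padic_Zp gD (v i 0); rewrite /g scale1r.
have phiM : phi *m red M = 0.
  (* Column [j] of [M] has class zero in the cokernel, so [f] vanishes on it. *)
  apply/rowP => j; rewrite [RHS]mxE.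
  have <- : f (pr (M *m delta_mx j 0)) = 0.
    rewrite -f0; congr f; apply/eqP; rewrite -pr0.
    rewrite -(@Quotient.idealrBE _ (@col_image p n M)) subr0.
    by apply/asboolP; exists (delta_mx j 0).
  by rewrite fE map_mxM mulmxA map_delta_mx -colE [in RHS]mxE.
exists phi; last first.
  apply: functional_extensionality_dep => y.
  by rewrite -[y]reprK cok_functional_pi // fE.
rewrite finset.inE phiM eqxx andbT; apply/eqP => phi0.
have [y _] := f_surj 1 I; rewrite -[y]reprK fE phi0 mul0mx mxE => /eqP.
by rewrite eq_sym oner_eq0.
Qed.

Lemma counting_Sur_cok (R : realType) :
  counting (Sur (cok M) 'Z_p) = (#|left_kernel_nonzero|%:R : R)%:E.
Proof.
rewrite Sur_cokE counting_image // => phi psi.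
rewrite !finset.inE => /andP[_ /eqP phiM] /andP[_ /eqP psiM] e.
by apply/rowP => i; rewrite -!cok_functional_delta // e.
Qed.

End Reduction.

(** The integrand is a finite combination of indicators of the fibres of [g]. *)
Lemma integral_finite_valued (R : realType) (d : measure_display)
    (T : measurableType d) (P : {measure set T -> \bar R}) (I : finType)
    (g : T -> I) (c : I -> R) :
  (forall i, measurable (g @^-1` [set i])) -> (forall i, 0 <= c i) ->
  (\int[P]_w (c (g w))%:E = \sum_i (c i)%:E * P (g @^-1` [set i]))%E.
Proof.
move=> mg c0.
have -> : (fun w => (c (g w))%:E) =
    (fun w => \sum_i (c i)%:E * (\1_(g @^-1` [set i]) w)%:E)%E.
  apply/funext => w; rewrite (bigD1 (g w)) //= big1 => [|i /eqP gi].
    by rewrite indicE mem_set // mule1 adde0.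
  by rewrite indicE memNset ?mule0 //= => /esym.
have m1 i : measurable_fun setT (EFin \o (\1_(g @^-1` [set i]) : T -> R)).
  exact/measurable_EFinP/measurable_indic.
rewrite ge0_integral_sum //.
- apply: eq_bigr => i _; rewrite ge0_integralZl_EFin //.
    by rewrite integral_indic // setIT.
  exact: m1.
- by move=> i; apply: (measurable_funeM (c i)%:E); exact: m1.
- by move=> i w _; rewrite mule_ge0 // lee_fin.
Qed.

(** * The law of the matrix modulo p and the expected number of surjections *)

Section HaarMatrix.
Variables (R : realType) (p : nat).
Hypothesis p_prime : prime p.
Let p_gt1 : (1 < p)%N. Proof. exact: prime_gt1. Qed.
Let card_Zp_p : #|'Z_p| = p. Proof. by rewrite card_ord Zp_cast. Qed.

Lemma measurable_reduction_fiber (a : 'Z_p) :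
  measurable [set x : padic p | reduction x = a].
Proof.
apply: sub_sigma_algebra; rewrite padic_openE => x /= xa.
by exists 0%N => y yx; rewrite /reduction yx.
Qed.

Lemma reduction_fiber_shift (a : 'Z_p) :
  [set x : padic p | reduction x = a] =
  [set (a : nat)%:R + x | x in [set x : padic p | reduction x = 0]].
Proof.
apply/seteqP; split => [x /= xa|_ [x /= x0 <-]]; last first.
  by rewrite rmorphD /= reduction_nat // x0 addr0.
exists (x - (a : nat)%:R); last by rewrite addrC subrK.
by rewrite rmorphB /= reduction_nat // xa subrr.
Qed.

Section Entry.
Variables (d : measure_display) (T : measurableType d) (P : probability T R).

(** The fibres of the reduction are translates of one another, so they share the total mass 1
    equally. *)
Lemma haar_reduction_uniform (Y : T -> padic p) (a : 'Z_p) :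
  measurable_fun setT Y -> is_haar (pushforward P Y) ->
  P (Y @^-1` [set x | reduction x = a]) = (p%:R^-1)%:E.
Proof.
move=> mY [_ Y_inv].
pose F b := Y @^-1` [set x : padic p | reduction x = b].
have mF b : measurable (F b).
  by rewrite -[F b]setTI; apply: mY => //; exact: measurable_reduction_fiber.
have PF b : P (F b) = P (F 0).
  have := Y_inv (b : nat)%:R _ (measurable_reduction_fiber 0).
  by rewrite -reduction_fiber_shift.
(* Integrating the constant 1 shows that the masses of the fibres add up to 1. *)
have := @integral_finite_valued R d T P 'Z_p (fun w => reduction (Y w))
  (fun=> 1) mF (fun=> ler01).
rewrite integral_cst //= probability_setT mule1.
under eq_bigr do rewrite mul1e PF.
rewrite -(fineK (fin_num_measure P _ (mF 0))) sumEFin sumr_const card_Zp_p.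
case=> e; rewrite -/(F a) PF -(fineK (fin_num_measure P _ (mF 0))).
have p0 : p%:R != 0 :> R by rewrite pnatr_eq0 -lt0n ltnW.
by congr EFin; apply: (mulIf p0); rewrite mulVf // mulr_natr.
Qed.

Variables (n : nat) (sigma : 'I_n -> {set 'I_n}) (X : T -> 'M[padic p]_n).
Hypothesis X_haar : haar_random_supported P sigma X.
Local Notation red w := (map_mx (@reduction p) (X w)).

Let entry_fiber (A : 'M['Z_p]_n) (ij : 'I_n * 'I_n) : set T :=
  (fun w => X w ij.1 ij.2) @^-1` [set x | reduction x = A ij.1 ij.2].

Let entry_fiber_measurable A ij : measurable (entry_fiber A ij).
Proof.
case: X_haar => mX _ _ _; rewrite -[entry_fiber A ij]setTI.
by apply: mX => //; exact: measurable_reduction_fiber.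
Qed.

Lemma measurable_reduction_mx (A : 'M['Z_p]_n) :
  measurable ((fun w => red w) @^-1` [set A]).
Proof.
have -> : (fun w => red w) @^-1` [set A] =
    \bigcap_(ij in [set: 'I_n * 'I_n]) entry_fiber A ij.
  apply/seteqP; split => [w <- ij _|w wA]; first by rewrite /entry_fiber /= mxE.
  by apply/matrixP => i j; rewrite mxE; exact: (wA (i, j)).
by apply: fin_bigcap_measurable => //; exact: finite_finset.
Qed.

(** Independence multiplies the uniform laws of the supported entries; all other entries vanish
    identically. *)
Lemma probability_reduction_mx (A : 'M['Z_p]_n) :
  P ((fun w => red w) @^-1` [set A]) =
  (if supported_mx sigma A then p%:R ^- (\sum_j #|sigma j|)%N else 0)%:E.
Proof.
case: X_haar => mX X0 X_unif X_indep; case: ifPn => [A_supp|A_supp].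
  pose D := [set ij : 'I_n * 'I_n | ij.1 \in sigma ij.2]%SET.
  have -> : (fun w => red w) @^-1` [set A] =
      \bigcap_(ij in [set` D]) entry_fiber A ij.
    apply/seteqP; split => [w <- ij _|w wA]; first by rewrite /entry_fiber /= mxE.
    apply/matrixP => i j; rewrite mxE.
    have [ij|ij] := boolP (i \in sigma j).
      by apply: (wA (i, j)); rewrite /= finset.inE.
    rewrite X0 // rmorph0; apply/esym/eqP.
    by move/forallP/(_ j)/forallP/(_ i)/implyP: A_supp; apply.
  rewrite (X_indep D (fun ij => [set x | reduction x = A ij.1 ij.2])) //; last first.
    by move=> ij _; exact: measurable_reduction_fiber.
  rewrite (eq_bigr (fun=> (p%:R^-1)%:E)); last first.
    move=> ij; rewrite finset.inE => ijD; rewrite haar_reduction_uniform //.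
    exact: X_unif.
  rewrite prodEFin prodr_const exprVn; congr (_ ^- _)%:E.
  rewrite -sum1_card (eq_bigl (fun ij : 'I_n * 'I_n => ij.1 \in sigma ij.2)).
    rewrite -(pair_big_dep xpredT (fun i j => i \in sigma j) (fun _ _ => 1%N)) /=.
    rewrite (exchange_big_dep xpredT) //=; apply: eq_bigr => j _.
    by rewrite sum1_card.
  by move=> ij; rewrite finset.inE.
rewrite (_ : _ @^-1` _ = set0) ?measure0 //; apply/seteqP; split => // w wA.
move/negP: A_supp; apply; apply/forallP => j; apply/forallP => i.
by apply/implyP => ij; rewrite -wA mxE X0 // rmorph0.
Qed.

(** All supported matrices modulo p are equally likely. Exchanging the sums over matrices and over
    [phi] leaves, for each [phi], the proportion it kills, given by [card_supported_mx_kernel]. *)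
Lemma expected_Sur_cok :
  (\int[P]_w (counting (Sur (cok (X w)) 'Z_p) : \bar R))%E =
  (\sum_(phi : 'rV['Z_p]_n | phi != 0)
     p%:R ^- #|columns_hit sigma (row_support phi)|)%:E.
Proof.
pose K (A : 'M['Z_p]_n) : {set 'rV['Z_p]_n} :=
  [set phi | (phi != 0) && (phi *m A == 0)]%SET.
have p0 : p%:R != 0 :> R by rewrite pnatr_eq0 -lt0n ltnW.
transitivity (\int[P]_w (#|K (red w)|%:R : R)%:E)%E.
  by apply: eq_integral => w _; rewrite counting_Sur_cok.
rewrite (integral_finite_valued P (c := fun A => #|K A|%:R)
  measurable_reduction_mx) //.
rewrite (eq_bigr _ (fun A _ => congr1 (mule _) (probability_reduction_mx A))).
under eq_bigr do rewrite -EFinM.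
rewrite sumEFin; congr EFin.
pose D := (\sum_j #|sigma j|)%N.
transitivity (\sum_(A | supported_mx sigma A) \sum_(phi in K A) p%:R ^- D : R).
  rewrite [RHS]big_mkcond; apply: eq_bigr => A _; case: ifP => _.
    by rewrite sumr_const mulr_natl.
  by rewrite mulr0.
rewrite (exchange_big_dep (fun phi : 'rV['Z_p]_n => phi != 0)) /=; last first.
  by move=> A phi _; rewrite finset.inE => /andP[].
apply: eq_bigr => phi phi0; rewrite sumr_const.
have /(congr1 (GRing.natmul (1 : R))) := card_supported_mx_kernel p_prime phi sigma.
rewrite natrM !natrX -/D => e; rewrite -[LHS]mulr_natl.
rewrite (@eq_card _ _ (mem (supported_mx_kernel phi sigma))); last first.
  by move=> A; rewrite !finset.inE unfold_in finset.inE phi0.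
by apply: (mulIf (expf_neq0 #|columns_hit sigma (row_support phi)| p0));
  rewrite mulVf ?expf_neq0 // mulrAC e divff // expf_neq0.
Qed.

Lemma expected_Sur_cokE :
  (\int[P]_w (counting (Sur (cok (X w)) 'Z_p) : \bar R))%E =
  (1 - p%:R ^- n + excess (p%:R : R) sigma)%:E.
Proof.
rewrite expected_Sur_cok -sum_columns_hit ?ltr1n //; congr EFin.
rewrite (sum_row_support p_prime (fun S => p%:R ^- #|columns_hit sigma S|)).
apply: eq_bigr => S _; rewrite -[LHS]mulr_natl natrX; congr (_ ^+ _ * _).
by rewrite -subn1 natrB // ltnW.
Qed.

End Entry.
End HaarMatrix.

(** * Capping t and passing to the limit *)

Section Truncation.
Variables (R : realType) (p : nat) (t : nat -> nat).
Hypothesis p_prime : prime p.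
Hypothesis t_cvg :
  ((t n)%:R - ln (n%:R : R) / ln (p%:R : R)) @[n --> \oo] --> +oo.
Let p_gt1 : (1 < p)%N. Proof. exact: prime_gt1. Qed.
Let q_gt0 : 0 < p%:R :> R. Proof. by rewrite ltr0n ltnW. Qed.
Let q_ge2 : 2 <= p%:R :> R. Proof. by rewrite ler_nat. Qed.
Let lnp_gt0 : 0 < ln (p%:R : R). Proof. by rewrite ln_gt0 // ltr1n. Qed.

(* Capping [t] makes it negligible with respect to the square root of [n]. *)
Definition capped n := minn (t n) (2 * trunc_log p n).+1.

Lemma capped_le n : (capped n <= t n)%N.
Proof. exact: geq_minl. Qed.

Lemma capped_gt0 n : (0 < t n)%N -> (0 < capped n)%N.
Proof. by move=> tn; rewrite leq_min tn. Qed.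

Lemma expR_ln_natX (m : nat) : expR (m%:R * ln (p%:R : R)) = p%:R ^+ m.
Proof. by rewrite expRM_natl lnK // posrE. Qed.

Lemma trunc_log_near (K : R) : \forall n \near \oo, K <= (trunc_log p n)%:R.
Proof.
pose k := (Num.truncn K).+1.
exists (p ^ k)%N => // n /= nk.
have : (k <= trunc_log p n)%N by exact: trunc_log_max.
rewrite -(ler_nat R); apply: le_trans; exact/ltW/truncnS_gt.
Qed.

Lemma cvg0_expRN (u : nat -> R) :
  u n @[n --> \oo] --> +oo -> expR (- u n) @[n --> \oo] --> 0.
Proof. by move=> u_oo; exact: cvg_comp u_oo (@cvgr_expR R). Qed.

Lemma cvgry_pMl (M : R) (u : nat -> R) : 0 < M ->
  u n @[n --> \oo] --> +oo -> M * u n @[n --> \oo] --> +oo.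
Proof.
move=> M0 /cvgryPge u_oo; apply/cvgryPge => K; near=> n.
by rewrite mulrC -ler_pdivrMr //; near: n; exact: u_oo.
Unshelve. all: by end_near. Qed.

Lemma trunc_log_ln_le n : (0 < n)%N ->
  (trunc_log p n)%:R <= ln (n%:R : R) / ln (p%:R : R).
Proof.
move=> n0; rewrite ler_pdivlMr // -ler_expR expR_ln_natX lnK ?posrE ?ltr0n //.
by rewrite -natrX ler_nat trunc_logP.
Qed.

(** Eventually [t n] is at least log_p n, and the cap always exceeds [trunc_log p n]; in particular
    [capped] tends to infinity. *)
Lemma trunc_log_le_capped :
  \forall n \near \oo, (trunc_log p n <= capped n)%N.
Proof.
have /cvgryPge/(_ 0) t_ge := t_cvg.
near=> n; rewrite leq_min; apply/andP; split; last first.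
  by rewrite ltnW // ltnS mul2n -addnn leq_addr.
rewrite -(ler_nat R) -subr_ge0.
have n0 : (0 < n)%N by near: n; exists 1%N.
apply: (@le_trans _ _ ((t n)%:R - ln (n%:R : R) / ln (p%:R : R))).
  by near: n.
by rewrite lerD2l lerN2 trunc_log_ln_le.
Unshelve. all: by end_near. Qed.

Lemma capped_near (K : R) : \forall n \near \oo, K <= (capped n)%:R.
Proof.
near=> n; apply: (@le_trans _ _ (trunc_log p n)%:R).
  by near: n; exact: trunc_log_near.
by rewrite ler_nat; near: n; exact: trunc_log_le_capped.
Unshelve. all: by end_near. Qed.

(** Where the cap is inactive the value is [expR (- u n)]. Where it is active, n < p^(L+1) with L =
    [trunc_log p n], so n^2 <= p^(2L+2) and the value is at most p/n. *)
Lemma capped_expr_cvg0 : (n%:R * p%:R ^- capped n : R) @[n --> \oo] --> (0 : R).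
Proof.
pose u n : R := ln (p%:R : R) * ((t n)%:R - ln (n%:R : R) / ln (p%:R : R)).
have u_oo : u n @[n --> \oo] --> +oo by exact: cvgry_pMl.
apply: (squeeze_cvgr (f := fun=> 0)
  (h := fun n => expR (- u n) + p%:R / n%:R)); last 2 first.
- exact: cvg_cst.
- rewrite -[0 in X in _ --> X]addr0; apply: cvgD; first exact: cvg0_expRN.
  rewrite -[0 in X in _ --> X](mulr0 (p%:R)); apply: cvgMr.
  by rewrite -cvg_shiftS; exact: cvg_harmonic.
near=> n; have n0 : (0 < n)%N by near: n; exists 1%N.
have N0 : 0 < n%:R :> R by rewrite ltr0n.
rewrite divr_ge0 ?exprn_ge0 //=.
have -> : expR (- u n) = n%:R * p%:R ^- t n.
  rewrite /u mulrBr mulrCA divff ?gt_eqF // mulr1 opprB expRD lnK ?posrE //.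
  by rewrite expRN mulrC [_ * (t n)%:R]mulrC expR_ln_natX mulrC.
rewrite /capped /minn; case: ifP => _; first by rewrite lerDl divr_ge0.
apply: ler_wpDl; first by rewrite divr_ge0 ?exprn_ge0.
rewrite ler_pdivlMr // mulrAC ler_pdivrMr ?exprn_gt0 // -natrM -natrX -natrM.
rewrite ler_nat -expnS -[_.+2]/(2 + 2 * _)%N -mulnS mulnC expnM -mulnn.
by rewrite leq_mul // ltnW // trunc_log_ltn.
Unshelve. all: by end_near. Qed.

Lemma capped_sqr_cvg : (n%:R / (capped n)%:R ^+ 2 : R) @[n --> \oo] --> +oo.
Proof.
apply/cvgryPge => K; near=> n.
have n0 : (0 < n)%N by near: n; exists 1%N.
have L_ge1 : 1 <= (trunc_log p n)%:R :> R by near: n; exact: trunc_log_near.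
(* With c <= 3L and n >= L^3/48 below, n/c^2 is at least L/432. *)
have L_geK : 432 * K <= (trunc_log p n)%:R by near: n; exact: trunc_log_near.
set L : R := (trunc_log p n)%:R in L_ge1 L_geK.
have c_ge1 : 1 <= (capped n)%:R :> R by near: n; exact: capped_near.
have c_gt0 : 0 < (capped n)%:R ^+ 2 :> R.
  by rewrite exprn_gt0 // (lt_le_trans _ c_ge1).
have c_le : (capped n)%:R <= 3 * L.
  apply: (@le_trans _ _ (2 * trunc_log p n).+1%:R); first by rewrite ler_nat geq_minr.
  by rewrite -natr1 natrM -/L; lra.
have n_ge : L ^+ 3 / 48 <= n%:R.
  apply: (@le_trans _ _ (p%:R ^+ trunc_log p n)); last first.
    by rewrite -natrX ler_nat trunc_logP.
  apply: (@le_trans _ _ (expR (L / 2))).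
    (* The cubic term of the exponential series at L/2 is L^3/48. *)
    have := @expR_ge1Dxn R (L / 2) 2 ltac:(lra).
    rewrite (_ : 3`! = 6%N) // => h; apply: le_trans h.
    by rewrite expr_div_n; lra.
  rewrite expRM_natl lerXn2r ?nnegrE ?expR_ge0 ?(ltW q_gt0) //.
  by apply: le_trans q_ge2; apply: (le_trans (expR_le_quadratic _)); lra.
rewrite ler_pdivlMr //; apply: le_trans n_ge.
apply: (@le_trans _ _ (L / 432 * (capped n)%:R ^+ 2)).
  by rewrite ler_wpM2r ?(ltW c_gt0) //; lra.
apply: (@le_trans _ _ (L / 432 * (3 * L) ^+ 2)); last by lra.
have L432 : 0 <= L / 432 by lra.
by rewrite (ler_wpM2l L432) // lerXn2r ?nnegrE //; lra.
Unshelve. all: by end_near. Qed.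

(** The terms vanish respectively because n p^(-c) tends to 0, n/c^2 tends to infinity, n tends to
    infinity, and the base of the last power is eventually at most 1/2; here c = [capped p t n]. *)
Lemma excess_bound_cvg0 (u : nat -> R) (q := p%:R : R)
    (e := (512 ^+ 2 * q ^+ 3)^-1) :
  (\forall n \near \oo, 0 <= u n <=
    2 * (expR (n%:R * (expR 1 * q * q ^- capped n)) - 1 +
          expR (n%:R * (expR 1 * q * (expR 8^-1 / q) ^+ capped n)
                - n%:R / (2 * q * (capped n)%:R ^+ 2)) +
          expR (3 / 8 - 10 * n%:R / (512 * q)) +
          (q * expR (- (e ^+ 2 * (capped n)%:R))) ^+ n)) ->
  u n @[n --> \oo] --> 0.
Proof.
move=> u_le.
have k_gt0 : 0 < 512 :> R by rewrite ltr0n.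
have kq_gt0 : 0 < 512 * q := mulr_gt0 k_gt0 q_gt0.
have e_gt0 : 0 < e ^+ 2.
  by rewrite exprn_gt0 // invr_gt0 (mulr_gt0 (exprn_gt0 2 k_gt0)) ?exprn_gt0.
pose b1 n := expR (expR 1 * q * (n%:R * q ^- capped n)) - 1.
pose b2 n := expR (- ((4 * q)^-1 * (n%:R / (capped n)%:R ^+ 2))).
pose b3 n := expR (3 / 8) * expR (- (10 / (512 * q) * n%:R)).
pose b4 n : R := 2^-1 ^+ n.
have b1_cvg : b1 n @[n --> \oo] --> 0.
  rewrite -(subrr 1) -[X in X - 1]expR0; apply: cvgB; last exact: cvg_cst.
  apply: continuous_cvg; first exact: continuous_expR.
  rewrite -[0 in X in _ --> X](mulr0 (expR 1 * q)); apply: cvgMr.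
  exact: capped_expr_cvg0.
have b2_cvg : b2 n @[n --> \oo] --> 0.
  apply: cvg0_expRN; apply: cvgry_pMl; last exact: capped_sqr_cvg.
  by rewrite invr_gt0 mulr_gt0.
have b3_cvg : b3 n @[n --> \oo] --> 0.
  rewrite -[0 in X in _ --> X](mulr0 (expR (3 / 8))); apply: cvgMr.
  apply: cvg0_expRN; apply: cvgry_pMl; last exact: cvgr_idn.
  by rewrite divr_gt0 ?ltr0n ?kq_gt0.
have b4_cvg : b4 n @[n --> \oo] --> 0.
  by apply: cvg_expr; rewrite ger0_norm; lra.
apply: (squeeze_cvgr (f := fun=> 0)
  (h := fun n => 2 * (b1 n + b2 n + b3 n + b4 n))); last 2 first.
- exact: cvg_cst.
- rewrite -[0 in X in _ --> X](mulr0 2); apply: cvgMr.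
  rewrite -[0 in X in _ --> X](addr0 0); apply: cvgD => //.
  rewrite -[0 in X in _ --> X](addr0 0); apply: cvgD => //.
  by rewrite -[0 in X in _ --> X](addr0 0); apply: cvgD.
near=> n.
have /andP[u0 u_le_n] : 0 <= u n <=
    2 * (expR (n%:R * (expR 1 * q * q ^- capped n)) - 1 +
          expR (n%:R * (expR 1 * q * (expR 8^-1 / q) ^+ capped n)
                - n%:R / (2 * q * (capped n)%:R ^+ 2)) +
          expR (3 / 8 - 10 * n%:R / (512 * q)) +
          (q * expR (- (e ^+ 2 * (capped n)%:R))) ^+ n) by near: n.
rewrite u0 /=; apply: (le_trans u_le_n); rewrite ler_pM2l //.
have c_ge1 : 1 <= (capped n)%:R :> R by near: n; exact: capped_near.
(* This makes the cubic term of exp(3c/8) dominate 4 [expR 1] q^2 c^2; the next threshold makes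
   exp(e^2 c) at least 2q. *)
have c_ge2 : 4 * expR 1 * q ^+ 2 * 1000 <= (capped n)%:R.
  by near: n; exact: capped_near.
have c_ge3 : 2 * q / e ^+ 2 <= (capped n)%:R by near: n; exact: capped_near.
set c : R := (capped n)%:R in c_ge1 c_ge2 c_ge3 *.
have c_gt0 : 0 < c by lra.
apply: lerD; first apply: lerD; first apply: lerD.
- by rewrite lerD2r ler_expR mulrCA.
- rewrite ler_expR.
  (* The positive part of the exponent then cancels at most half of n/(2qc^2). The rate 3/8 comes
     from e^(1/8)/q <= e^(-3/8), that is, from e^(1/2) <= q. *)
  have x2_le : expR 1 * q * (expR 8^-1 / q) ^+ capped n <= (4 * q * c ^+ 2)^-1.
    rewrite -[leRHS]mul1r ler_pdivlMr ?mulr_gt0 ?exprn_gt0 //.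
    apply: (@le_trans _ _ (expR 1 * q * expR (- (3 / 8 * c)) * (4 * q * c ^+ 2))).
      rewrite ler_wpM2r ?mulr_ge0 ?exprn_ge0 ?(ltW c_gt0) ?(ltW q_gt0) //.
      rewrite ler_wpM2l ?mulr_ge0 ?expR_ge0 ?(ltW q_gt0) //.
      rewrite (_ : - (3 / 8 * c) = (capped n)%:R * (- (3 / 8)));
        last by rewrite -/c; lra.
      rewrite expRM_natl lerXn2r ?nnegrE ?expR_ge0 ?mulr_ge0 ?expR_ge0 ?invr_ge0
        ?(ltW q_gt0) //.
      rewrite ler_pdivrMr //; apply: (@le_trans _ _ (expR (- (3 / 8)) * expR 2^-1)).
        by rewrite -expRD ler_expR; lra.
      rewrite ler_wpM2l ?expR_ge0 //; apply: le_trans q_ge2.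
      by apply: (le_trans (expR_le_quadratic _)); lra.
    rewrite expRN mulrAC ler_pdivrMr ?expR_gt0 // mul1r.
    apply: (@le_trans _ _ (c ^+ 3 / 1000)).
      have := ler_wpM2r (exprn_ge0 2 (ltW c_gt0)) c_ge2.
      lra.
    have := @expR_ge1Dxn R (3 / 8 * c) 2 ltac:(lra).
    rewrite (_ : 3`! = 6%N) // => h; apply: le_trans h.
    have : 0 <= c ^+ 3 by rewrite exprn_ge0 // ltW.
    by rewrite exprMn; lra.
  have := ler_wpM2l (ler0n R n) x2_le; rewrite !invfM.
  set x := n%:R * (expR 1 * _ * _).
  move: (n%:R : R) q^-1 (c ^- 2) => N w v; lra.
- have -> : 10 * n%:R / (512 * q) = 10 / (512 * q) * n%:R by lra.
  by rewrite expRD.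
- rewrite lerXn2r ?nnegrE ?mulr_ge0 ?expR_ge0 ?(ltW q_gt0) //.
  rewrite expRN ler_pdivrMr ?expR_gt0 //.
  have := expR_ge1Dx (e ^+ 2 * c).
  by move: c_ge3; rewrite ler_pdivrMr //; lra.
Unshelve. all: by end_near. Qed.

End Truncation.

(** * Choice of the supports and the limit of the expectation *)

Theorem theorem4p5 (R : realType) (p : nat) (t : nat -> nat) :
  prime p ->
  (forall n, (0 < n)%N -> (0 < t n <= n)%N) ->
  ((t n)%:R - ln (n%:R : R) / ln (p%:R : R)) @[n --> \oo] --> +oo ->
  exists sigma : forall n, 'I_n -> {set 'I_n},
    [/\ forall n (i : 'I_n), (1 <= #|sigma n i| <= t n)%N,
        forall n, (\bigcup_(i < n) sigma n i = [set: 'I_n])%SET &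
        forall (d : nat -> measure_display)
          (T : forall n, measurableType (d n))
          (P : forall n, probability (T n) R)
          (X : forall n, T n -> 'M[padic p]_n),
        (forall n, haar_random_supported (P n) (sigma n) (X n)) ->
        (\int[P n]_w (counting (Sur (cok (X n w)) 'Z_p) : \bar R))%E
          @[n --> \oo] --> (1%:E : \bar R)].
Proof.
move=> p_prime t_bnd t_cvg.
have p_gt1 := prime_gt1 p_prime.
have q_gt1 : 1 < p%:R :> R by rewrite ltr1n.
have q_ge2 : 2 <= p%:R :> R by rewrite ler_nat.
(* The supports are built from [capped] permutations instead of [t n]; the size bound survives since
   the cap only lowers [t]. *)
pose ex n := cid (exists_perm_support n (capped p t n) q_gt1).
pose f n := sval (ex n); have f_le n := svalP (ex n).
pose sigma n := perm_support (f n).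
have ord_gt0 n (i : 'I_n) : (0 < n)%N := leq_ltn_trans (leq0n i) (ltn_ord i).
have cap_gt0 n : (0 < n)%N -> (0 < capped p t n)%N.
  by move=> /t_bnd/andP[t0 _]; exact: capped_gt0.
exists sigma; split.
- move=> n i; apply/andP; split.
    rewrite card_gt0; apply/finset.set0Pn.
    by exists (f n (Ordinal (cap_gt0 _ (ord_gt0 _ i))) i); apply/imsetP; eexists.
  apply: leq_trans (leq_imset_card _ _) _.
  by rewrite card_ord capped_le.
- move=> n; apply/finset.setP => i; rewrite finset.inE; apply/finset.bigcupP.
  (* A single permutation already covers every row, and there is at least one since [capped] is
     positive. *)
  pose k := Ordinal (cap_gt0 _ (ord_gt0 _ i)).
  exists ((f n k)^-1%g i) => //; apply/imsetP; exists k => //.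
  by rewrite permKV.
- move=> d T P X X_haar.
  under eq_fun do rewrite (expected_Sur_cokE p_prime (X_haar _)).
  apply: cvg_EFin; first by near=> n.
  have excess_cvg : excess (p%:R : R) (sigma n) @[n --> \oo] --> 0.
    apply: (excess_bound_cvg0 p_prime t_cvg); near=> n.
    have n_gt0 : (0 < n)%N by near: n; exists 1%N.
    rewrite excess_ge0 //=; apply: le_trans (f_le n) _.
    exact: average_excess_le (cap_gt0 _ n_gt0).
  rewrite -[1 in X in _ --> X]addr0 -[1 in X in _ --> X]subr0.
  apply: cvgD => //; apply: cvgB; first exact: cvg_cst.
  under eq_fun do rewrite -exprVn.
  apply: cvg_expr; rewrite ger0_norm ?invr_ge0 //.
  by rewrite invf_lt1 // (lt_trans ltr01).
Unshelve. all: by end_near.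
Qed.
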